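(* Let $\sigma\subset\mathbb{C}$ be nonempty and compact, let $X$ be a complex Banach space and let $T\in B(X)$ be an $AC(\sigma)$ operator of type (B), with functional calculus map $\psi:AC(\sigma)\to B(X)$. For every $\theta\in\mathbb{T}$ and $\mu\in\mathbb{R}$ the limit $E(H(\theta,\mu))=\lim_{\delta\to0^+}\psi(h_{\theta,\mu,\delta})$ exists in the weak operator topology, and $\{E(H)\}_{H\in\mathcal{H}}$ is a half-plane spectral family on $X$. Moreover, with $T_\theta=\int_{\sigma_\theta}\mu\,dE(H(\theta,\mu))$ for $\theta\in\mathbb{T}$, one has $T=\theta T_\theta+i\theta T_{i\theta}$ for every $\theta\in\mathbb{T}$; in particular $T=T_1+iT_i$, so $T$ is recovered from the half-plane spectral family.
   Context: Let $\sigma\subset\mathbb{C}\cong\mathbb{R}^2$ be nonempty and compact. Let $\Gamma=C([0,1],\mathbb{C})$ be the set of curves. For $\gamma\in\Gamma$ and $f:\sigma\to\mathbb{C}$ put $\operatorname{cvar}(f,\gamma)=\sup\sum_{i=1}^{n-1}|f(s_{i+1})-f(s_i)|$, the supremum over finite sequences $s_i=\gamma(t_i)\in\sigma$ with $0\le t_1\le\dots\le t_n\le 1$. For a line $l$, $\operatorname{vf}(\gamma,l)$ is the number of times $\gamma$ crosses $l$, i.e. the number of entry points: $t\in[0,1]$ with $\gamma(t)\in l$ and either $t=0$ or for every $\epsilon>0$ there is $s\in(t-\epsilon,t)\cap[0,1]$ with $\gamma(s)\notin l$. Put $\operatorname{vf}(\gamma)=\sup_l\operatorname{vf}(\gamma,l)$,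 $\rho(\gamma)=1/\operatorname{vf}(\gamma)$ (with $\rho(\gamma)=0$ if $\operatorname{vf}(\gamma)=\infty$), $\operatorname{var}(f,\sigma)=\sup_{\gamma\in\Gamma}\rho(\gamma)\operatorname{cvar}(f,\gamma)$, and $\|f\|_{BV(\sigma)}=\|f\|_\infty+\operatorname{var}(f,\sigma)$. $BV(\sigma)$ is the Banach algebra of all $f:\sigma\to\mathbb{C}$ with $\|f\|_{BV(\sigma)}<\infty$, and $AC(\sigma)$ is the closed subalgebra of $BV(\sigma)$ generated by $1$, $\boldsymbol{\lambda}$ and $\overline{\boldsymbol{\lambda}}$, where $\boldsymbol{\lambda}(z)=z$, with the $BV(\sigma)$ norm. $T\in B(X)$ is an $AC(\sigma)$ operator if there is a bounded unital algebra homomorphism $\psi:AC(\sigma)\to B(X)$ (a functional calculus map) with $\psi(\boldsymbol{\lambda})=T$. It is of type (B) (with functional calculus map $\psi$) if for each $x\in X$ the map $AC(\sigma)\to X$, $f\mapsto\psi(f)x$, is weakly compact. $\mathbb{T}$ is the unit circle; $\theta\in\mathbb{T}$ is identified with the corresponding unit vector in $\mathbb{R}^2$ and $z\cdot\theta$ is the real dot product. $H(\theta,\mu)=\{z\in\mathbb{R}^2: z\cdot\theta\le\mu\}$, and $\mathcal{H}$ is the set of all such closed half-planes. $\sigma_\theta=\{z\cdot\theta: z\in\sigma\}$. For $\mu\in\mathbb{R}$, $\delta>0$, $g_{\mu,\delta}:\mathbb{R}\to\mathbb{R}$ is $1$ on $(-\infty,\mu]$, $0$ on $[\mu+\delta,\infty)$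 and linear on $[\mu,\mu+\delta]$; $h_{\theta,\mu,\delta}(z)=g_{\mu,\delta}(z\cdot\theta)$ for $z\in\sigma$ (this is in $AC(\sigma)$). A spectral family of projections is a uniformly bounded projection-valued map $F:\mathbb{R}\to B(X)$ with $F(\mu)F(\nu)=F(\min(\mu,\nu))$, right continuous with left limits in the strong operator topology, with $F(\mu)\to I$ as $\mu\to\infty$ and $F(\mu)\to0$ as $\mu\to-\infty$ strongly. A half-plane spectral family on $X$ is a family of projections $\{E(H)\}_{H\in\mathcal{H}}$ in $B(X)$ such that: (1) $E(H_1)E(H_2)=E(H_2)E(H_1)$ for all $H_1,H_2\in\mathcal{H}$; (2) there is $K$ with $\|E(H)\|\le K$ for all $H$; (3) for all $\theta\in\mathbb{T}$, $\{E(H(\theta,\mu))\}_{\mu\in\mathbb{R}}$ is a spectral family of projections; (4) for all $\theta\in\mathbb{T}$, if $\mu_1<\mu_2$ then $E(H(\theta,\mu_1))E(H(-\theta,-\mu_2))=0$. The integral $\int_{\sigma_\theta}\mu\,dE(H(\theta,\mu))$ is taken in the usual sense for spectral families: for any compact interval $[a,b]\supseteq\sigma_\theta$ it is $aE(H(\theta,a))$ plus the strong operator limit, over partitions $a=t_0<\dots<t_n=b$ of mesh tending to $0$, of $\sum_{j=1}^n t_j\,(E(H(\theta,t_j))-E(H(\theta,t_{j-1})))$. *)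

(* Defs.v *)
From HB Require Import structures.
From mathcomp Require Import all_boot all_order all_algebra.
From mathcomp Require Import all_classical all_reals all_analysis.
From mathcomp Require Import complex.

(* Scalars are [R[i]] for an abstract [R : realType], so
   the norm of a [normedModType R[i]] takes its (real) values in [R[i]]. *)

Set Implicit Arguments.
Unset Strict Implicit.
Unset Printing Implicit Defensive.

Import Order.TTheory GRing.Theory Num.Theory.
Import numFieldNormedType.Exports.

Local Open Scope classical_set_scope.
Local Open Scope ring_scope.
Local Open Scope complex_scope.

(* The topology of [R[i]] is that of its modulus, as for any numFieldType. *)
HB.instance Definition _ (R : rcfType) := NormedModule.copy R[i] R[i]^o.

Section Operators.
Variable R : realType.
Implicit Types V W X : normedModType R[i].

Definition rnorm V (v : V) : R := complex.Re `|v|.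

Definition opnorm V W (f : V -> W) : \bar R :=
  ereal_sup [set (rnorm (f v))%:E | v in [set v : V | `|v| <= 1]].

Record bounded_linear V W := BoundedLinear {
  bounded_linear_map :> {linear V -> W};
  bounded_linear_bounded : (opnorm bounded_linear_map < +oo)%E }.

Definition bounded_op X := bounded_linear X X.

Definition sot_cvg I X (F : set_system I) (A : I -> bounded_op X)
    (B : X -> X) :=
  forall x : X, A t x @[t --> F] --> B x.

Definition wot_cvg I X (F : set_system I) (A : I -> bounded_op X)
    (B : X -> X) :=
  forall (x : X) (phi : bounded_linear X R[i]),
    phi (A t x) @[t --> F] --> phi (B x).

(* [X] with its weak topology: the coarsest one for which every bounded
   linear functional is continuous. *)
Definition weak X : topologicalType :=
  sup_topology (fun phi : bounded_linear X R[i] =>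
    Topological.class (initial_topology phi)).

Definition projection X (P : bounded_op X) := forall x, P (P x) = P x.

Definition spectral_family X (F : R -> bounded_op X) :=
  [/\ exists K : R, forall mu, (opnorm (F mu) <= K%:E)%E,
      forall mu, projection (F mu),
      forall mu nu x, F mu (F nu x) = F (Num.min mu nu) x &
   [/\ forall mu, sot_cvg mu^'+ F (F mu),
       forall mu, exists L : bounded_op X, sot_cvg mu^'- F L,
       sot_cvg +oo F id &
       sot_cvg -oo F (cst 0)]].

Definition mesh (a : R) (s : seq R) : R :=
  \big[Num.max/0]_(j < size s) (nth 0 (a :: s) j.+1 - nth 0 (a :: s) j).

(* A partition a = t_0 < ... < t_n = b is encoded by the library's
   [itv_partition a b s] with s = [:: t_1; ...; t_n]; if a = b, the only one
   is s = [::], whose sum is empty. *)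
Definition stieltjes_sum X (F : R -> bounded_op X) (a : R) (s : seq R)
    (x : X) : X :=
  \sum_(j < size s) (nth 0 (a :: s) j.+1)%:C *:
    (F (nth 0 (a :: s) j.+1) x - F (nth 0 (a :: s) j) x).

(* [S] is the integral of [mu] with respect to [dF(mu)] over [D]. *)
Definition is_spectral_integral X (D : set R) (F : R -> bounded_op X)
    (S : bounded_op X) :=
  forall a b : R, D `<=` `[a, b] ->
  forall (x : X) (e : R), 0 < e -> exists2 eta : R, 0 < eta &
    forall s, itv_partition a b s -> mesh a s < eta ->
      rnorm (S x - (a%:C *: F a x + stieltjes_sum F a s x)) < e.

End Operators.

Section Plane.
Variable R : realType.
Implicit Types (z theta : R[i]) (mu : R) (gamma : R -> R[i]).

Definition dot z theta : R :=
  complex.Re z * complex.Re theta + complex.Im z * complex.Im theta.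

Definition circle : set R[i] := [set theta | `|theta| = 1].

Definition half_plane theta mu : set R[i] := [set z | dot z theta <= mu].

Definition half_planes : set (set R[i]) :=
  [set H | exists theta mu, circle theta /\ H = half_plane theta mu].

Definition lines : set (set R[i]) :=
  [set l | exists theta mu, circle theta /\ l = [set z | dot z theta = mu]].

(* Curves are maps on all of [R] of which only the restriction to [0, 1] is
   constrained and used. *)
Definition curves : set (R -> R[i]) :=
  [set gamma : R -> R[i] | {within `[0, 1], continuous gamma}].

Definition entry_points gamma (l : set R[i]) : set R :=
  [set t | [/\ 0 <= t <= 1, l (gamma t) &
    t = 0 \/ forall e : R, 0 < e ->
      exists s, [/\ t - e < s < t, 0 <= s <= 1 & ~ l (gamma s)]]].

Definition vf gamma : \bar R :=
  ereal_sup [set counting (entry_points gamma l) | l in lines].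

(* [+oo^-1 = 0] *)
Definition rho gamma : \bar R := ((vf gamma)^-1)%E.

End Plane.

Section FunctionAlgebras.
Variables (R : realType) (sigma : set R[i]).
Implicit Types (f g : sigma -> R[i]) (gamma : R -> R[i]).

(* Only the values of [t] and [s] at indices below [n] matter; [n = 0] gives
   the empty sum, so that the supremum is 0 if [gamma] misses [sigma]. *)
Definition cvar f gamma : \bar R :=
  ereal_sup [set v | exists (n : nat) (t : nat -> R) (s : nat -> sigma),
    [/\ forall i, (i < n)%N -> 0 <= t i <= 1 /\ val (s i) = gamma (t i),
        forall i, (i.+1 < n)%N -> t i <= t i.+1 &
        v = (\sum_(i < n.-1) rnorm (f (s i.+1) - f (s i)))%:E]].

(* [0 * +oo = 0]: curves with infinite variation factor do not contribute. *)
Definition var f : \bar R :=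
  ereal_sup [set (rho gamma * cvar f gamma)%E | gamma in @curves R].

Definition supnorm f : \bar R := ereal_sup [set (rnorm (f z))%:E | z in setT].

Definition bvnorm f : \bar R := (supnorm f + var f)%E.

Definition BVfun : set (sigma -> R[i]) := [set f | (bvnorm f < +oo)%E].

Definition lambda : sigma -> R[i] := fun z => val z.

Definition lambda_bar : sigma -> R[i] := fun z => (val z)^*.

Definition closed_subalgebra (A : set (sigma -> R[i])) :=
  [/\ A `<=` BVfun,
      forall f g, A f -> A g -> A (f + g) /\ A (f * g),
      forall (c : R[i]) f, A f -> A (c *: f) &
      forall f, BVfun f ->
        (forall e : R, 0 < e -> exists2 g, A g & (bvnorm (f - g)%R < e%:E)%E) ->
        A f].

Definition ACfun : set (sigma -> R[i]) :=
  \bigcap_(A in [set A | [/\ closed_subalgebra A, A 1, A lambda &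
                              A lambda_bar]]) A.

Definition ramp (mu delta t : R) : R :=
  if t <= mu then 1 else if mu + delta <= t then 0 else (mu + delta - t) / delta.

Definition half_plane_ramp (theta : R[i]) (mu delta : R) : sigma -> R[i] :=
  fun z => (ramp mu delta (dot (val z) theta))%:C.

Variable X : completeNormedModType R[i].
Implicit Types psi : (sigma -> R[i]) -> bounded_op X.

(* A map AC(sigma) -> B(X) is encoded by a total map on functions
   sigma -> R[i], of which only the values on [ACfun] are constrained. *)
Definition is_functional_calculus psi (T : bounded_op X) :=
  [/\ forall f g x, ACfun f -> ACfun g -> psi (f + g) x = psi f x + psi g x,
      forall (c : R[i]) f x, ACfun f -> psi (c *: f) x = c *: psi f x,
      forall f g x, ACfun f -> ACfun g -> psi (f * g) x = psi f (psi g x),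
      forall x, psi 1 x = x &
   (exists K : R, forall f, ACfun f -> (opnorm (psi f) <= K%:E * bvnorm f)%E) /\
   psi lambda = T].

Definition is_type_B psi :=
  forall x : X, precompact
    ((fun f => psi f x) @` [set f | ACfun f /\ (bvnorm f <= 1)%E] : set (weak X)).

End FunctionAlgebras.

(* The values of [E] outside [half_planes] are irrelevant. *)
Definition half_plane_spectral_family (R : realType)
    (X : completeNormedModType R[i]) (E : set R[i] -> bounded_op X) :=
  [/\ forall H, half_planes H -> projection (E H),
      forall H1 H2 x, half_planes H1 -> half_planes H2 ->
        E H1 (E H2 x) = E H2 (E H1 x),
      exists K : R, forall H, half_planes H -> (opnorm (E H) <= K%:E)%E,
      forall theta, circle theta ->
        spectral_family (fun mu => E (half_plane theta mu)) &
      forall theta mu1 mu2 x, circle theta -> mu1 < mu2 ->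
        E (half_plane theta mu1) (E (half_plane (- theta) (- mu2)) x) = 0].

(* Main.v *)
Require Import Defs.
From HB Require Import structures.
From mathcomp Require Import all_boot all_order all_algebra.
From mathcomp Require Import finmap.
From mathcomp Require Import all_classical all_reals all_analysis.
From mathcomp Require Import complex.
From mathcomp Require Import ring lra.

Set Implicit Arguments.
Unset Strict Implicit.
Unset Printing Implicit Defensive.

Import Order.TTheory GRing.Theory Num.Theory.
Import numFieldNormedType.Exports.

Local Open Scope classical_set_scope.
Local Open Scope ring_scope.
Local Open Scope complex_scope.

(** Fix a direction [theta] and write [h_(mu, d)] for the function
    [half_plane_ramp theta mu d].  The proof rests on estimates in the BV norm,
    a mean ergodic argument, and identities between ramps.

    Estimates.  Let [f z = F (dot z theta)] with [F] monotone of oscillation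
    [V].  Whenever [dot _ theta] along a curve passes from one side of a value
    to the other, the curve enters a line orthogonal to [theta], so a curve with
    variation factor [N] accumulates at most [N * V] ([monotone_sum_le],
    [crossings_le_entry_points]) and [var f <= V] ([var_plane_fun_le]).  Hence
    ramps have BV norm at most 2 and, by splitting into monotone pieces,
    [h_(nu, d') * (1 - h_(mu, d))] has norm at most [4 * (nu + d' - mu) / d]
    for [mu <= nu] ([bvnorm_ramp_diff_le]).  Ramps lie in AC because
    [t |-> `|t - c|] is a limit of polynomials in variation norm on bounded
    sets ([AC_plane_abs]).

    Limits.  By the last estimate the operators [psi h_(mu, d)] asymptotically
    form a decreasing family of commuting projections as [d] tends to 0, and
    type (B) confines each orbit to a weakly compact set.  A weak cluster
    point [y] of [psi h_(mu, d) x] is then fixed by all of them, and [x - y]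
    lies in the closed subspace of the vectors sent to 0 in the limit, which is
    weakly closed by Hahn-Banach.  So [psi h_(mu, d) x] converges to [y] in
    norm ([mean_ergodic], [calc_ramp_cvg]).

    The family.  Every algebraic property of the limits [E theta mu] comes from
    an identity between ramps: [h_(mu, d) * h_(nu, d') = h_(mu, d)] when
    [mu + d <= nu], and the fact that [1 - h_(mu - d, d)] is the ramp of width
    [d] of the opposite half-plane.  The same BV estimate gives right
    continuity, and the second identity gives the left limit at [mu], namely
    [1 - E (- theta) (- mu)].

    The integral.  For a partition [a = t_0 < ... < t_n = b] the ramps on the
    cells satisfy the exact identity
    [t = b - sum_j (t_(j+1) - t_j) * ramp t_j (t_(j+1) - t_j) t] on [[a, b]]
    ([sum_ramp]).  So [psi] of the function [dot z theta] differs from the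
    Stieltjes sum by at most a constant times the sum over the cells of the
    length times the oscillation of [E theta _ x], which tends to 0 since
    [E theta _ x] has one-sided limits ([mesh_sum_cvg0]).  Finally
    [z = theta * dot z theta + i theta * dot z (i theta)] for every unit vector
    [theta], and [psi] of this identity recovers [T]. *)

(** * Real-valued norms on complex normed spaces *)

Section Norm.
Variable R : realType.
Implicit Types V W X : normedModType R[i].

Lemma normE V (v : V) : `|v| = (rnorm v)%:C.
Proof.
rewrite /rnorm; have := ger0_Im (normr_ge0 v).
by case: (`|v|) => a b /= ->.
Qed.

Lemma rnorm_ge0 V (v : V) : 0 <= rnorm v.
Proof. by have := normr_ge0 v; rewrite normE ler0c. Qed.

Lemma rnorm0 V : rnorm (0 : V) = 0.
Proof. by apply: complexI; rewrite -normE normr0. Qed.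

Lemma rnorm_eq0 V (v : V) : rnorm v = 0 -> v = 0.
Proof. by move=> v0; apply/eqP; rewrite -normr_eq0 normE v0. Qed.

Lemma rnormN V (v : V) : rnorm (- v) = rnorm v.
Proof. by rewrite /rnorm normrN. Qed.

Lemma rnormB V (v w : V) : rnorm (v - w) = rnorm (w - v).
Proof. by rewrite -rnormN opprB. Qed.

Lemma rnormD V (v w : V) : rnorm (v + w) <= rnorm v + rnorm w.
Proof. by rewrite -lecR rmorphD /= -!normE ler_normD. Qed.

Lemma rnorm_triangle V (u v w : V) : rnorm (v - w) <= rnorm (v - u) + rnorm (u - w).
Proof. by rewrite (le_trans _ (rnormD _ _))// addrA subrK. Qed.

Lemma rnormZ V (c : R[i]) (v : V) : rnorm (c *: v) = rnorm c * rnorm v.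
Proof. by apply: complexI; rewrite rmorphM /= -!normE normrZ. Qed.

Lemma rnormM (c d : R[i]) : rnorm (c * d) = rnorm c * rnorm d.
Proof. by rewrite -rnormZ. Qed.

Lemma rnorm_real (r : R) : rnorm (r%:C : R[i]) = `|r|.
Proof. by rewrite /rnorm normc_def /= expr0n addr0 sqrtr_sqr. Qed.

Lemma rnorm_i : rnorm ('i%C : R[i]) = 1.
Proof. by rewrite /rnorm normc_def /= expr0n add0r expr1n sqrtr1. Qed.

Lemma rnormZr V (r : R) (v : V) : 0 <= r -> rnorm (r%:C *: v) = r * rnorm v.
Proof. by move=> r0; rewrite rnormZ rnorm_real ger0_norm. Qed.

Lemma rnorm_sum V I (s : seq I) (P : pred I) (f : I -> V) :
  rnorm (\sum_(i <- s | P i) f i) <= \sum_(i <- s | P i) rnorm (f i).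
Proof.
elim/big_rec2: _ => [|i x v _ h]; first by rewrite rnorm0.
by rewrite (le_trans (rnormD _ _))// lerD2l.
Qed.

(** Bridge between the topology, whose radii are positive elements of [R[i]],
    and estimates with real radii. *)
Lemma cvg_rnormP I (F : set_system I) {FF : Filter F} V (f : I -> V) (l : V) :
  f @ F --> l <-> forall e : R, 0 < e -> \forall t \near F, rnorm (l - f t) < e.
Proof.
split=> [/cvgrPdist_lt fl e e0|fl].
  have e0' : 0 < e%:C by rewrite ltcR.
  by have := fl _ e0'; apply: filterS => t; rewrite normE ltcR.
apply/cvgrPdist_lt => e; rewrite ltcE /= => /andP[/eqP Ie e0].
have := fl _ e0; apply: filterS => t; rewrite normE ltcE /= Ie => ->.
by rewrite eqxx.
Qed.

Lemma opnorm_le V W (f : {linear V -> W}) (K : R) :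
  (forall v, rnorm (f v) <= K * rnorm v) -> 0 <= K -> (opnorm f <= K%:E)%E.
Proof.
move=> fK K0; apply: ge_ereal_sup => _ [v /= v1 <-]; rewrite lee_fin.
rewrite (le_trans (fK v))// ler_piMr//.
by rewrite -lecR -normE.
Qed.

Lemma le_opnorm V W (f : {linear V -> W}) (K : R) v :
  (opnorm f <= K%:E)%E -> rnorm (f v) <= K * rnorm v.
Proof.
move=> fK; have [->|v0] := eqVneq v 0; first by rewrite linear0 !rnorm0 mulr0.
have nv0 : 0 < rnorm v.
  by rewrite lt_neqAle rnorm_ge0 andbT eq_sym; apply: contra v0 => /eqP/rnorm_eq0->.
have nv0' : 0 <= (rnorm v)^-1 by rewrite invr_ge0 ltW.
have : ((rnorm (f ((rnorm v)^-1%:C *: v)))%:E <= K%:E)%E.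
  apply: le_trans fK; apply: ereal_sup_ubound; exists ((rnorm v)^-1%:C *: v) => //=.
  by rewrite normE rnormZr// mulVf ?gt_eqF.
by rewrite lee_fin linearZ /= rnormZr// ler_pdivrMl// mulrC.
Qed.

Lemma bounded_linearP V W (f : bounded_linear V W) :
  exists2 K : R, 0 <= K & forall v, rnorm (f v) <= K * rnorm v.
Proof.
have := bounded_linear_bounded f; case E : (opnorm f) => [K| |].
- move=> _; exists (Num.max K 0); first by rewrite le_max lexx orbT.
  move=> v; apply: (le_trans (@le_opnorm _ _ f K v _)); first by rewrite E.
  by rewrite ler_wpM2r ?rnorm_ge0// le_max lexx.
- by rewrite ltxx.
- by move=> _; exists 0 => // v; apply: (@le_opnorm _ _ f 0); rewrite E leNye.
Qed.

Lemma bounded_linear_of V W (f : V -> W) (K : R) :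
  (forall c u v, f (c *: u + v) = c *: f u + f v) ->
  (forall v, rnorm (f v) <= K * rnorm v) ->
  exists g : bounded_linear V W, g =1 f.
Proof.
move=> fl fK.
pose m := GRing.isLinear.Build R[i] V W *:%R f fl.
pose F : {linear V -> W} := HB.pack f m.
have h : (opnorm F < +oo)%E.
  apply: (@le_lt_trans _ _ (Num.max K 0)%:E); last exact: ltry.
  apply: opnorm_le; last by rewrite le_max lexx orbT.
  by move=> v; rewrite (le_trans (fK v))// ler_wpM2r ?rnorm_ge0// le_max lexx.
by exists (BoundedLinear h).
Qed.

End Norm.

Section Limits.
Variables (R : realType) (I : Type) (F : set_system I).
Context {FF : ProperFilter F}.
Implicit Types V W : normedModType R[i].

Lemma cvg_rnorm_le V (f : I -> V) (l : V) (B : R) :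
  f @ F --> l -> (\forall t \near F, rnorm (f t) <= B) -> rnorm l <= B.
Proof.
move=> /cvg_rnormP fl fB; apply/ler_addgt0Pl => e e0.
have [t [lt ftB]] := filter_ex (filterI (fl e e0) fB).
rewrite -[l](subrK (f t)) (le_trans (rnormD _ _))//.
by rewrite lerD// ltW.
Qed.

Lemma rcvg_unique V (f : I -> V) (l l' : V) : f @ F --> l -> f @ F --> l' -> l = l'.
Proof. by move=> fl fl'; apply: (cvg_unique (@norm_hausdorff _ V) fl fl'). Qed.

Lemma cvg_bounded_linear V W (B : bounded_linear V W) (f : I -> V) (l : V) :
  f @ F --> l -> B (f t) @[t --> F] --> B l.
Proof.
move=> /cvg_rnormP fl; have [K K0 BK] := bounded_linearP B.
apply/cvg_rnormP => e e0.
have eK : 0 < e / (K + 1) by rewrite divr_gt0// ltr_wpDl.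
have := fl _ eK; apply: filterS => t.
rewrite ltr_pdivlMr ?ltr_wpDl// => h; rewrite -linearB (le_lt_trans (BK _))//.
by rewrite (le_lt_trans _ h)// mulrC ler_wpM2l ?rnorm_ge0// lerDl.
Qed.

Lemma cvg_near_cst V (f : I -> V) (l : V) :
  (\forall t \near F, f t = l) -> f @ F --> l.
Proof.
move=> fl; apply/cvg_rnormP => e e0; apply: filterS fl => t ->.
by rewrite subrr rnorm0.
Qed.

Lemma cvg_near_eq V (f g : I -> V) (l : V) :
  (\forall t \near F, g t = f t) -> f @ F --> l -> g @ F --> l.
Proof.
move=> gf /cvg_rnormP fl; apply/cvg_rnormP => e e0.
by apply: filterS2 gf (fl e e0) => t ->.
Qed.

End Limits.
Arguments cvg_bounded_linear {R I F FF V W} B {f l} _.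

(** * The Hahn-Banach theorem and separation from a closed subspace *)

Section HahnBanach.
Variables (R : realType) (V : lmodType R[i]).
Implicit Types (p q u : V -> R) (x y z : V) (s t : R).

(** Positive homogeneity is only required as an inequality; equality follows
    from it ([sublinear_scale]). *)
Definition sublinear p :=
  (forall x y, p (x + y) <= p x + p y) /\
  (forall t x, 0 <= t -> p (t%:C *: x) <= t * p x).

Lemma sublinearN p x : sublinear p -> - p (- x) <= p x.
Proof.
case=> pD pZ; rewrite lerNl -subr_ge0 opprK.
have p00 : p 0 <= 0 by have := pZ 0 0 (lexx _); rewrite scaler0 mul0r.
have := pD 0 0; rewrite addr0 => p0.
by have := pD (- x) x; rewrite addNr; lra.
Qed.

Lemma sublinear_scale p t x : sublinear p -> 0 <= t -> p (t%:C *: x) = t * p x.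
Proof.
move=> sp t0; have [pD pZ] := sp; apply/eqP; rewrite eq_le pZ//=.
move: t0; rewrite [0 <= t]le_eqVlt => /predU1P[<-|t0].
  rewrite mul0r scale0r; have := pD 0 0; rewrite addr0; lra.
have := pZ t^-1 (t%:C *: x); rewrite invr_ge0 (ltW t0) => /(_ isT).
rewrite scalerA -rmorphM /= mulVf ?gt_eqF// scale1r.
by rewrite ler_pdivlMl.
Qed.

(** Zorn: along a chain the pointwise infimum is again sublinear, and
    [- p (- x)] bounds it from below. *)
Lemma minimal_sublinear p : sublinear p ->
  exists u, [/\ sublinear u, forall x, u x <= p x &
    forall q, sublinear q -> (forall x, q x <= u x) -> q = u].
Proof.
move=> sp; have [pD pZ] := sp.
pose T := {q : V -> R | sublinear q /\ forall x, q x <= p x}.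
pose le (q1 q2 : T) := `[< forall x, sval q2 x <= sval q1 x >].
have [//|q r s /asboolP qr /asboolP rs|q r /asboolP qr /asboolP rq|A totA|] :=
  @Zorn T le.
- by move=> q; apply/asboolP.
- by apply/asboolP => x; rewrite (le_trans (rs x)).
- case: q r qr rq => q [? ?] [r [? ?]] /= qr rq.
  by apply: eq_exist; apply/funext => x; apply/eqP; rewrite eq_le qr rq.
- have [[a Aa]|A0] := pselect (exists a, A a); last first.
    by exists (exist _ p (conj sp (fun x => lexx _))) => q Aq; exfalso; apply: A0; exists q.
  pose S x := [set sval q x | q in A].
  have S0 x : S x !=set0 by exists (sval a x), a.
  have Slb x : has_lbound (S x).
    exists (- p (- x)) => _ [[q [sq qp]] /= Aq <-].
    by rewrite (le_trans _ (sublinearN x sq))// lerN2 qp.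
  pose m x := inf (S x).
  have mle (b : T) x : A b -> m x <= sval b x by move=> Ab; apply: ge_inf => //; exists b.
  have sm : sublinear m.
    split=> [x y|t x t0].
      rewrite -lerBlDr; apply: lb_le_inf => // _ [q Aq <-].
      rewrite lerBlDr -lerBlDl; apply: lb_le_inf => // _ [r Ar <-].
      rewrite lerBlDr; have [/asboolP qr|/asboolP rq] := totA _ _ Aq Ar.
        rewrite (le_trans (mle _ (x + y) Ar))//.
        rewrite (le_trans ((svalP r).1.1 x y))// addrC lerD2l; exact: qr.
      rewrite (le_trans (mle _ (x + y) Aq))//.
      rewrite (le_trans ((svalP q).1.1 x y))// addrC lerD2r; exact: rq.
    move: t0; rewrite [0 <= t]le_eqVlt => /predU1P[<-|t0].
      by rewrite mul0r (le_trans (mle _ _ Aa))// (le_trans ((svalP a).1.2 0 x _))// mul0r.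
    rewrite -ler_pdivrMl//; apply: lb_le_inf => // _ [q Aq <-].
    by rewrite ler_pdivrMl// (le_trans (mle _ _ Aq))// ((svalP q).1.2 t x _)// ltW.
  have mp x : m x <= p x by rewrite (le_trans (mle _ _ Aa))// (svalP a).2.
  by exists (exist _ m (conj sm mp)) => q Aq; apply/asboolP => x /=; exact: mle.
move=> [u [su up]] umax; exists u; split => // q sq qu.
have qp x : q x <= p x by rewrite (le_trans (qu x)).
have := umax (exist _ q (conj sq qp)).
by move=> /(_ _)/(f_equal sval) /=; apply; apply/asboolP.
Qed.

(** The largest sublinear functional below [p] whose value at [- y] is at most
    [- p y]. *)
Definition tilt p y x := inf [set p (x + t%:C *: y) - t * p y | t in [set t | 0 <= t]].

Lemma tilt_le p x y t : sublinear p -> 0 <= t ->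
  tilt p y x <= p (x + t%:C *: y) - t * p y.
Proof.
move=> sp t0; apply: ge_inf; last by exists t.
exists (- p (- x)) => _ [s /= s0 <-].
rewrite lerBrDr -(sublinear_scale _ sp)// addrC lerBlDr.
by rewrite (le_trans _ (sp.1 _ _))// addrAC subrr add0r.
Qed.

Lemma le_tilt p x y : sublinear p -> tilt p y x <= p x.
Proof.
move=> sp; rewrite (le_trans (tilt_le x y sp (lexx 0)))//.
by rewrite scale0r addr0 mul0r subr0.
Qed.

Lemma sublinear_tilt p y : sublinear p -> sublinear (tilt p y).
Proof.
move=> sp; have [pD pZ] := sp.
have S0 x : [set p (x + t%:C *: y) - t * p y | t in [set t | 0 <= t]] !=set0.
  by exists (p (x + 0%:C *: y) - 0 * p y), 0 => //=.
split=> [x z|r x].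
  rewrite -lerBlDr; apply: lb_le_inf => // _ [s /= s0 <-].
  rewrite lerBlDr -lerBlDl; apply: lb_le_inf => // _ [t /= t0 <-].
  rewrite lerBlDr (le_trans (tilt_le _ _ sp (addr_ge0 s0 t0)))//.
  have -> : x + z + (s + t)%:C *: y = (x + s%:C *: y) + (z + t%:C *: y).
    by rewrite rmorphD /= scalerDl addrACA.
  have := pD (x + s%:C *: y) (z + t%:C *: y).
  lra.
rewrite [0 <= r]le_eqVlt => /predU1P[<-|r0].
  rewrite mul0r scale0r (le_trans (le_tilt _ _ sp))//.
  by have := pZ 0 0 (lexx _); rewrite scaler0 mul0r.
rewrite -ler_pdivrMl//; apply: lb_le_inf => // _ [t /= t0 <-].
rewrite ler_pdivrMl//.
rewrite (le_trans (tilt_le _ _ sp (mulr_ge0 (ltW r0) t0)))//.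
by rewrite mulrBr mulrA lerD2r rmorphM /= -scalerA -scalerDr pZ// ltW.
Qed.

(** A minimal functional equals its own tilts. *)
Lemma sublinear_minimalN u : sublinear u ->
  (forall q, sublinear q -> (forall x, q x <= u x) -> q = u) ->
  forall x, u (- x) = - u x.
Proof.
move=> su umin x; apply/eqP; rewrite eq_le; apply/andP; split; last first.
  by have := sublinearN (- x) su; rewrite opprK.
rewrite -{1}(umin _ (sublinear_tilt x su) (fun z => le_tilt z x su)).
rewrite (le_trans (tilt_le _ _ su ler01))// scale1r addNr mul1r.
have := su.2 0 0 (lexx _); rewrite scaler0 mul0r; lra.
Qed.

(** A minimal sublinear functional is odd, hence linear; below the tilt of [p]
    at [x0] its value at [x0] is [p x0]. *)
Lemma hahn_banach p x0 : sublinear p ->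
  exists u, [/\ forall x y, u (x + y) = u x + u y,
    forall t x, u (t%:C *: x) = t * u x,
    forall x, u x <= p x & u x0 = p x0].
Proof.
move=> sp.
have [u [su up umin]] := minimal_sublinear (sublinear_tilt x0 sp).
have uN := sublinear_minimalN su umin.
exists u; split.
- move=> x y; apply/eqP; rewrite eq_le su.1 /=.
  have := su.1 (x + y) (- y); rewrite addrK uN; lra.
- move=> t x; have [t0|t0] := leP 0 t; first exact: sublinear_scale.
  rewrite -[t]opprK rmorphN scaleNr uN sublinear_scale// ?mulNr//.
  by rewrite oppr_ge0 ltW.
- by move=> x; rewrite (le_trans (up x))// le_tilt.
- apply/eqP; rewrite eq_le (le_trans (up _) (le_tilt _ _ sp)) /=.
  rewrite -lerN2 -uN (le_trans (up _))//.
  rewrite (le_trans (tilt_le _ _ sp ler01))// scale1r addNr mul1r.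
  have := sp.2 0 0 (lexx _); rewrite scaler0 mul0r; lra.
Qed.

End HahnBanach.

Section Separation.
Variables (R : realType) (X : normedModType R[i]).

(** Apply [hahn_banach] to the distance to [W], a seminorm that vanishes on
    [W] and not at [x0]; the real-linear functional [u] so obtained is the real
    part of [x |-> u x - i u (i x)]. *)
Lemma separate_closed_subspace (W : set X) (x0 : X) :
  W 0 -> (forall c u v, W u -> W v -> W (c *: u + v)) ->
  (forall x, (forall e : R, 0 < e -> exists2 w, W w & rnorm (x - w) < e) -> W x) ->
  ~ W x0 ->
  exists phi : bounded_linear X R[i], (forall w, W w -> phi w = 0) /\ phi x0 <> 0.
Proof.
move=> W0 Wlin Wcl Wx0.
have WZ c w : W w -> W (c *: w).
  by move=> Ww; have := Wlin c w 0 Ww W0; rewrite addr0.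
have WD u v : W u -> W v -> W (u + v).
  by move=> Wu Wv; have := Wlin 1 u v Wu Wv; rewrite scale1r.
pose p x := inf [set rnorm (x - w) | w in W].
have S0 x : [set rnorm (x - w) | w in W] !=set0 by exists (rnorm (x - 0)), 0.
have plb x : lbound [set rnorm (x - w) | w in W] 0.
  by move=> _ [w _ <-]; exact: rnorm_ge0.
have ple x w : W w -> p x <= rnorm (x - w).
  by move=> Ww; apply: ge_inf; [exists 0; exact: plb|exists w].
have p_ge0 x : 0 <= p x by apply: lb_le_inf; [exact: S0|exact: plb].
have p_le x : p x <= rnorm x by rewrite (le_trans (ple x 0 W0))// subr0.
have sp : sublinear p.
  split=> [x y|t x t0].
    rewrite -lerBlDr; apply: lb_le_inf => // _ [v Wv <-].
    rewrite lerBlDr -lerBlDl; apply: lb_le_inf => // _ [w Ww <-].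
    rewrite lerBlDr (le_trans (ple _ _ (WD _ _ Wv Ww)))//.
    by rewrite opprD addrACA addrC (le_trans (rnormD _ _))// addrC.
  move: t0; rewrite [0 <= t]le_eqVlt => /predU1P[<-|t0].
    by rewrite mul0r scale0r (le_trans (p_le _))// rnorm0.
  rewrite -ler_pdivrMl//; apply: lb_le_inf => // _ [w Ww <-].
  rewrite ler_pdivrMl// (le_trans (ple _ _ (WZ t%:C _ Ww)))//.
  by rewrite -scalerBr rnormZr// ltW.
have px0 : 0 < p x0.
  rewrite lt_neqAle p_ge0 andbT; apply/eqP => p0; apply: Wx0; apply: Wcl => e e0.
  have hi : has_inf [set rnorm (x0 - w) | w in W] by split=> //; exists 0; exact: plb.
  have [_ [w Ww <-]] := inf_adherent e0 hi.
  by rewrite -/(p x0) -p0 add0r; exists w.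
have [u [uD uZ up ux0]] := hahn_banach x0 sp.
have uN x : u (- x) = - u x.
  by have := uZ (-1) x; rewrite rmorphN1 scaleN1r mulN1r.
have u_norm x : `|u x| <= p x.
  rewrite ler_norml up andbT lerNl -uN (le_trans (up _))//.
  apply: lb_le_inf => // _ [w Ww <-]; rewrite (le_trans (ple _ (- w) _))//.
    by rewrite -scaleN1r; exact: WZ.
  by rewrite opprK addrC -[X in _ <= rnorm X]opprB rnormN.
have uW w : W w -> u w = 0.
  move=> Ww; apply/eqP; rewrite -normr_le0 (le_trans (u_norm w))//.
  by rewrite (le_trans (ple _ _ Ww))// subrr rnorm0.
pose f x : R[i] := (u x)%:C - 'i%C * (u ('i%C *: x))%:C.
have [|x|phi phiE] := @bounded_linear_of R X R[i] f 2.
- move=> c x y.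
  rewrite /f.
  have uc (z : X) : u (c *: z) = complex.Re c * u z + complex.Im c * u ('i%C *: z).
    by rewrite {1}[c]complexE scalerDl uD uZ ['i%C * _]mulrC -scalerA uZ.
  rewrite uD uc scalerDr uD scalerA [_ * c]mulrC -scalerA uc scalerA -expr2 sqr_i.
  rewrite scaleN1r uN.
  move: (u x) (u y) (u ('i *: x)) (u ('i *: y)) => a b a' b'.
  case: c {uc} => c d /=; rewrite [_ *: _]/( _ * _).
  by simpc; apply/eqP; rewrite eq_complex /=; apply/andP; split; apply/eqP; ring.
- rewrite /f (le_trans (rnormD _ _))// rnormN rnormM rnorm_i mul1r !rnorm_real.
  have := le_trans (u_norm x) (p_le x).
  have := le_trans (u_norm ('i%C *: x)) (p_le _).
  rewrite rnormZ rnorm_i mul1r; lra.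
exists phi; split=> [w Ww|].
  by rewrite phiE /f !uW// ?mulr0 ?subr0//; exact: WZ.
rewrite phiE /f ux0 => /eqP; rewrite eq_complex /= => /andP[/eqP + _].
rewrite !mul0r mul1r !subr0 => h.
by move: px0; rewrite -h; lra.
Qed.

Lemma bounded_linear_sep (x : X) :
  (forall phi : bounded_linear X R[i], phi x = 0) -> x = 0.
Proof.
move=> phix; apply: contrapT => x0.
have [//|c u v -> ->|y yl|//|phi [_]] := @separate_closed_subspace [set 0] x.
- by rewrite scaler0 addr0.
- apply: rnorm_eq0; apply/eqP; rewrite eq_le rnorm_ge0 andbT; apply/ler_addgt0Pl => e e0.
  by have [_ ->] := yl _ e0; rewrite subr0 addr0 => /ltW.
- by apply; exact: phix.
Qed.

End Separation.

(** * Weak cluster points and the mean ergodic argument *)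

Section WeakTopology.
Variables (R : realType) (X : normedModType R[i]).

Lemma weak_nbhs (phi : bounded_linear X R[i]) (y : X) (e : R) : 0 < e ->
  nbhs (y : weak X) [set z : weak X | rnorm (phi y - phi (z : X)) < e].
Proof.
move=> e0.
have /cvg_sup/(_ phi) h : nbhs (y : weak X) --> (y : weak X) by exact: cvg_id.
apply: h.
have /cvg_rnormP/(_ e e0) := @initial_continuous X R[i] phi y.
exact.
Qed.

(** A cluster point in the weak topology, described only through the
    functionals along which the family converges. *)
Lemma weak_cluster (I : Type) (F : set_system I) {PF : ProperFilter F}
    (C : set (weak X)) (a : I -> X) :
  compact C -> (\forall t \near F, C (a t)) ->
  exists y : X, forall (phi : bounded_linear X R[i]) (c : R[i]),
    phi (a t) @[t --> F] --> c -> phi y = c.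
Proof.
move=> cC Ca.
have [y [_ cl]] := cC ((a : I -> weak X) @ F) _ Ca.
exists y => phi c /cvg_rnormP phic; apply/eqP; rewrite -subr_eq0; apply/eqP.
apply: rnorm_eq0; apply/eqP; rewrite eq_le rnorm_ge0 andbT; apply/ler_addgt0Pl => e e0.
have e20 : 0 < e / 2 by rewrite divr_gt0.
have [z [/= zc zy]] := cl [set z | rnorm (c - phi z) < e / 2] _ (phic _ e20) (weak_nbhs phi y e20).
rewrite addr0 (le_trans (rnorm_triangle (phi z) _ _))// [e]splitr ltW// ltrD//.
by rewrite rnormB.
Qed.

(** Abstract mean ergodic theorem: relative weak compactness of one orbit of
    an asymptotically idempotent bounded family gives norm convergence. *)
Lemma mean_ergodic (I : Type) (F : set_system I) {PF : ProperFilter F}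
    (D : set I) (A : I -> bounded_op X) (K : R) (C : set (weak X)) (x : X) :
  F D -> (forall t v, D t -> rnorm (A t v) <= K * rnorm v) ->
  compact C -> (forall t, D t -> C (A t x)) ->
  (forall s, D s -> A t (x - A s x) @[t --> F] --> (0 : X)) ->
  (forall s, D s -> A s (A t x) - A t x @[t --> F] --> (0 : X)) ->
  exists y : X, A t x @[t --> F] --> y.
Proof.
move=> FD AK cC CA Ax AA.
have [y yP] : exists y : X, forall (phi : bounded_linear X R[i]) (c : R[i]),
    phi (A t x) @[t --> F] --> c -> phi y = c.
  by apply: (weak_cluster cC); exact: filterS FD.
have Ay s : D s -> A s y = y.
  move=> Ds; apply/eqP; rewrite -subr_eq0; apply/eqP/bounded_linear_sep => phi.
  have [Kp Kp0 phiK] := bounded_linearP phi.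
  have [Ks Ks0 AsK] := bounded_linearP (A s).
  have [|v|psi psiE] := @bounded_linear_of R X R[i] (fun v => phi (A s v - v)) (Kp * (Ks + 1)).
  - move=> c u v; rewrite -linearP; congr (phi _).
    by rewrite linearP scalerBr opprD addrACA.
  - rewrite (le_trans (phiK _))// -mulrA ler_wpM2l// (le_trans (rnormD _ _))//.
    by rewrite rnormN mulrDl mul1r lerD2r.
  rewrite -psiE; apply: yP; rewrite -(linear0 phi).
  by apply: cvg_near_eq (cvg_bounded_linear phi (AA s Ds)); apply: nearW => t; rewrite psiE.
(* [W] is a closed subspace by uniform boundedness and contains every
   [x - A s x], hence, by separation, the weak cluster point [x - y]. *)
pose W : set X := [set w | A t w @[t --> F] --> (0 : X)].
have Wxy : W (x - y).
  apply: contrapT => Wxy.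
  have [|c u v Wu Wv|w Wcl|//|phi [phiW]] := @separate_closed_subspace R X W (x - y).
  - rewrite /W /=; under eq_fun do rewrite linear0; exact: cvg_cst.
  - rewrite /W /=.
    have -> : (fun t => A t (c *: u + v)) = (fun t => c *: A t u + A t v).
      by apply/funext => t; rewrite linearP.
    rewrite -[0 : X]addr0 -[0 : X in X in _ --> X + _](scaler0 _ c).
    by apply: cvgD => //; apply: cvgZr.
  - apply/cvg_rnormP => e e0.
    have K10 : 0 < `|K| + 1 by rewrite ltr_wpDl.
    have [v Wv vw] : exists2 v, W v & rnorm (w - v) < e / 2 / (`|K| + 1).
      by apply: Wcl; rewrite !divr_gt0.
    move: Wv => /cvg_rnormP/(_ (e / 2)); rewrite divr_gt0// => /(_ isT).
    apply: filterS2 FD => t Dt; rewrite !sub0r !rnormN => Atv.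
    rewrite -[w](subrK v) linearD (le_lt_trans (rnormD _ _))// [e]splitr ltr_leD//; last exact: ltW.
    move: vw; rewrite ltr_pdivlMr// => vw; apply: le_lt_trans vw.
    rewrite (le_trans (AK _ _ Dt))// mulrC ler_wpM2l ?rnorm_ge0//.
    by rewrite (le_trans (ler_norm _))// lerDl.
  - apply; rewrite linearB; apply/eqP; rewrite subr_eq0 eq_sym; apply/eqP; apply: yP.
    apply/cvg_rnormP => e e0; apply: filterS FD => t Dt.
    by rewrite -linearB phiW ?rnorm0//; exact: Ax.
exists y; apply/cvg_rnormP => e e0.
move: Wxy => /cvg_rnormP/(_ e e0); apply: filterS2 FD => t Dt.
by rewrite linearB (Ay _ Dt) sub0r rnormN rnormB.
Qed.

End WeakTopology.

(** * Counting crossings of a level *)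

Section Crossings.
Variable R : realType.
Implicit Types (f F : R -> R) (a b c x : R).

(** The point sought is the infimum of the times in [[a, b]] at which [f] is at
    least [c]; stated with explicit moduli so that it applies to curves that
    are continuous on [[0, 1]] only. *)
Lemma first_passage_up f a b c : a <= b ->
  (forall t, a <= t <= b -> forall e, 0 < e -> exists2 d, 0 < d &
     forall s, a <= s <= b -> `|t - s| < d -> `|f t - f s| < e) ->
  f a < c < f b ->
  exists e, [/\ a < e < b, f e = c & forall s, a <= s < e -> f s <> c].
Proof.
move=> ab fc /andP[fac cfb].
pose S := [set s | a <= s <= b /\ c <= f s].
have Sb : S b by split; rewrite ?ab ?lexx// ltW.
have Slb : lbound S a by move=> s [/andP[]].
have hS : has_inf S by split; [exists b|exists a].
pose e := inf S.
have ae : a <= e by apply: lb_le_inf => //; exists b.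
have eb : e <= b by apply: ge_inf => //; exists a.
have below s : a <= s < e -> f s < c.
  move=> /andP[as_ se]; rewrite ltNge; apply/negP => cfs.
  have : e <= s by apply: ge_inf; [exists a|split => //; rewrite as_ (le_trans (ltW se))].
  by rewrite leNgt se.
have fe : f e = c.
  apply/eqP; rewrite eq_le !leNgt; apply/andP; split; apply/negP => h.
  - have [||d d0 dP] := fc e _ (f e - c); rewrite ?ae ?subr_gt0//.
    have ae' : a < e.
      by rewrite lt_neqAle ae andbT; apply/eqP => aE; move: h; rewrite -aE ltNge (ltW fac).
    pose s := Num.max a (e - d / 2).
    have se : s < e by rewrite gt_max ae' ltrBlDr ltrDl divr_gt0.
    have as_ : a <= s by rewrite le_max lexx.
    have sd : e - d / 2 <= s by rewrite le_max lexx orbT.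
    have /= := below s; rewrite as_ se => /(_ isT) fsc.
    have := dP s; rewrite as_ (le_trans (ltW se) eb) => /(_ isT).
    rewrite ger0_norm ?subr_ge0 1?ltW// => /(_ _) hh.
    have /hh : e - s < d by lra.
    rewrite ger0_norm; last by rewrite subr_ge0; lra.
    lra.
  - have [||d d0 dP] := fc e _ (c - f e); rewrite ?ae ?subr_gt0//.
    have [s [/andP[as_ sb] cfs]] := inf_adherent d0 hS; rewrite -/e => sed.
    have es : e <= s.
      by rewrite leNgt; apply/negP => se; have := below s; rewrite as_ se => /(_ isT); lra.
    have := dP s; rewrite as_ sb distrC ger0_norm ?subr_ge0// => /(_ isT) hh.
    have /hh : s - e < d by lra.
    rewrite distrC ger0_norm; last by rewrite subr_ge0; lra.
    lra.
exists e; split => //; last by move=> s /below + fs; rewrite fs ltxx.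
apply/andP; split; rewrite lt_neqAle ?ae ?eb andbT; apply/eqP => eE.
  by move: fac; rewrite eE fe ltxx.
by move: cfb; rewrite -eE fe ltxx.
Qed.

Lemma first_passage f a b c : a <= b ->
  (forall t, a <= t <= b -> forall e, 0 < e -> exists2 d, 0 < d &
     forall s, a <= s <= b -> `|t - s| < d -> `|f t - f s| < e) ->
  (f a < c < f b) || (f b < c < f a) ->
  exists e, [/\ a < e < b, f e = c & forall s, a <= s < e -> f s <> c].
Proof.
move=> ab fc /orP[|h]; first exact: first_passage_up.
have [||e [aeb fe es]] := @first_passage_up (fun t => - f t) a b (- c) ab.
- move=> t tab e e0; have [d d0 dP] := fc t tab e e0.
  by exists d => // s sab /dP -/(_ sab); rewrite -opprD normrN.
- by rewrite !ltrN2 andbC.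
exists e; split => //; first exact: oppr_inj.
by move=> s /es + fs; rewrite fs.
Qed.

Lemma sum_indicator_telescope (G : nat -> R) (a b k : nat) : (a <= b <= k)%N ->
  \sum_(j < k) (if (a <= j < b)%N then G j.+1 - G j else 0) = G b - G a.
Proof.
move=> /andP[ab bk].
rewrite -(big_mkord xpredT (fun j => if (a <= j < b)%N then G j.+1 - G j else 0)).
rewrite (big_cat_nat (leq0n b) bk)/= (big_cat_nat (leq0n a) ab)/=.
rewrite [X in X + _ + _]big_nat big1 ?add0r; last first.
  by move=> j /andP[_ ja]; rewrite leqNgt ja.
rewrite [X in _ + X]big_nat [X in _ + X]big1 ?addr0; last first.
  by move=> j /andP[bj _]; rewrite ltnNge bj andbF.
rewrite -(telescope_sumr G ab); apply: eq_big_nat => j /andP[-> ->] //.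
Qed.

Definition between c x y := (x < c < y) || (y < c < x).

(** Cut the range of [F] at the finitely many values of [x].  The increment of
    [F] over each gap is counted once for every step of the sequence that jumps
    over the midpoint of the gap, that is at most [N] times, and the increments
    of all gaps add up to at most [V]. *)
Lemma monotone_sum_le (m : nat) (x : nat -> R) F (D : set R) (N V : R) :
  (forall i, (i <= m)%N -> D (x i)) ->
  (forall u v, D u -> D v -> u <= v -> 0 <= F v - F u <= V) -> 0 <= N ->
  (forall c, #|[pred i : 'I_m | between c (x i) (x i.+1)]|%:R <= N) ->
  \sum_(i < m) `|F (x i.+1) - F (x i)| <= N * V.
Proof.
move=> xD FV N0 xN.
(* The values of [x] in increasing order, without repetition. *)
pose y := sort <=%R (undup (map x (iota 0 m.+1))).
have xy i : (i <= m)%N -> x i \in y.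
  by move=> im; rewrite mem_sort mem_undup map_f// mem_iota.
have yD u : u \in y -> D u.
  rewrite mem_sort mem_undup => /mapP[j].
  by rewrite mem_iota => /andP[_ jm] ->; exact: xD.
have ys : sorted <%R y by rewrite sort_lt_sorted undup_uniq.
have ylt i j : (i < size y)%N -> (j < size y)%N ->
    (nth 0 y i < nth 0 y j) = (i < j)%N.
  by move=> iy jy; rewrite lt_sorted_ltn_nth.
have yle i j : (i < size y)%N -> (j < size y)%N ->
    (nth 0 y i <= nth 0 y j) = (i <= j)%N.
  by move=> iy jy; rewrite lt_sorted_leq_nth.
have y0 : (0 < size y)%N by case: (y) (xy 0 (leq0n _)).
pose k := (size y).-1.
have kE : size y = k.+1 by rewrite prednK.
pose ix i := index (x i) y.
have ixk i : (i <= m)%N -> (ix i <= k)%N by move=> /xy; rewrite -index_mem kE.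
have ixE i : (i <= m)%N -> nth 0 y (ix i) = x i by move=> im; rewrite nth_index// xy.
pose G j := F (nth 0 y j).
pose mid (j : nat) := (nth 0 y j + nth 0 y j.+1) / 2.
have dG0 j : (j < k)%N -> 0 <= G j.+1 - G j.
  move=> jk; have [|||+ _] := andP (FV (nth 0 y j) (nth 0 y j.+1) _ _ _) => //.
  - by apply: yD; rewrite mem_nth// kE ltnW.
  - by apply: yD; rewrite mem_nth// kE.
  - by rewrite yle ?kE// ltnW.
have step_up i i' : (i <= m)%N -> (i' <= m)%N -> (ix i <= ix i')%N ->
    `|F (x i') - F (x i)| <=
      \sum_(j < k) (if between (mid j) (x i) (x i') then G j.+1 - G j else 0).
  move=> im i'm ii'; rewrite -(ixE _ im) -(ixE _ i'm) -/(G _) -/(G _).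
  rewrite ger0_norm; last first.
    have [|||+ _] := andP (FV (nth 0 y (ix i)) (nth 0 y (ix i')) _ _ _) => //.
    - by apply: yD; rewrite ixE// xy.
    - by apply: yD; rewrite ixE// xy.
    - by rewrite yle// kE ltnS ixk.
  rewrite -(@sum_indicator_telescope _ _ _ k) ?ii' ?ixk//.
  apply: ler_sum => j _; case: ifPn => [/andP[ij ji']|_]; last by case: ifP => // _; exact: dG0.
  rewrite ifT// /between /mid.
  have jk : (j < k)%N by [].
  have h1 : nth 0 y (ix i) <= nth 0 y j by rewrite yle ?kE ?ltnS ?ixk// ltnW.
  have h2 : nth 0 y j.+1 <= nth 0 y (ix i') by rewrite yle ?kE ?ltnS ?ixk// ltnW.
  have h3 : nth 0 y j < nth 0 y j.+1 by rewrite ylt ?kE ?ltnS// ltnW.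
  by apply/orP; left; apply/andP; split; lra.
have step (i : 'I_m) : `|F (x i.+1) - F (x i)| <=
    \sum_(j < k) (if between (mid j) (x i) (x i.+1) then G j.+1 - G j else 0).
  have [ii|/ltnW ii] := leqP (ix i) (ix i.+1); first by apply: step_up => //; exact: ltnW.
  rewrite distrC; under eq_bigr do rewrite /between orbC.
  by apply: step_up => //; exact: ltnW.
apply: (le_trans (ler_sum _ (fun i _ => step i))); rewrite exchange_big /=.
apply: (@le_trans _ _ (\sum_(j < k) N * (G j.+1 - G j))).
  apply: ler_sum => j _; rewrite -big_mkcond /= sumr_const -mulr_natl.
  by rewrite ler_wpM2r ?dG0//; apply: le_trans (xN (mid j)).
rewrite -mulr_sumr ler_wpM2l// -(big_mkord xpredT (fun j => G j.+1 - G j)).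
rewrite telescope_sumr//.
have [|||_] := andP (FV (nth 0 y 0) (nth 0 y k) _ _ _) => //.
- by apply: yD; rewrite mem_nth// kE.
- by apply: yD; rewrite mem_nth// kE.
- by rewrite yle ?kE.
Qed.

End Crossings.

(** * Variation of functions of one linear coordinate *)

Section Dot.
Variable R : realType.
Implicit Types (z w theta : R[i]).

Lemma circleE theta : circle theta ->
  complex.Re theta ^+ 2 + complex.Im theta ^+ 2 = 1.
Proof. by move=> th; apply: complexI; rewrite add_Re2_Im2 th expr1n. Qed.

Lemma rnormE z : rnorm z = Num.sqrt (complex.Re z ^+ 2 + complex.Im z ^+ 2).
Proof. by rewrite /rnorm normc_def. Qed.

Lemma dot_norm_le z theta : circle theta -> `|dot z theta| <= rnorm z.
Proof.
move=> /circleE th; rewrite rnormE -sqrtr_sqr ler_wsqrtr// /dot.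
rewrite -[leRHS]mulr1 -th; case: z theta {th} => [a b] [c d] /=.
have := sqr_ge0 (a * d - b * c); nra.
Qed.

Lemma dotB z w theta : dot (z - w) theta = dot z theta - dot w theta.
Proof. by case: z w theta => [a b] [c d] [e f]; rewrite /dot /=; ring. Qed.

Lemma dotN z theta : dot z (- theta) = - dot z theta.
Proof. by case: z theta => [a b] [c d]; rewrite /dot /=; ring. Qed.

Lemma circleN theta : circle theta -> circle (- theta).
Proof. by rewrite /circle /= normrN. Qed.

End Dot.

Section PlaneVariation.
Variables (R : realType) (sigma : set R[i]).
Implicit Types (gamma : R -> R[i]) (theta : R[i]).

Lemma curve_dot_continuous gamma theta : circle theta -> curves gamma ->
  forall t, 0 <= t <= 1 -> forall e : R, 0 < e -> exists2 d : R, 0 < d &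
    forall s, 0 <= s <= 1 -> `|t - s| < d ->
      `|dot (gamma t) theta - dot (gamma s) theta| < e.
Proof.
move=> th /subspace_continuousP gc t t01 e e0.
have /gc/cvg_rnormP/(_ e e0) : `[0, 1]%classic t by rewrite /= in_itv.
rewrite /within /= => /nbhs_ballP[d d0 dP]; exists d => // s s01 tsd.
by rewrite -dotB (le_lt_trans (dot_norm_le _ th))//; apply: dP => //; rewrite /= in_itv.
Qed.

(** Each step across the level [c] contains a first passage, which is an entry
    point of the line, and the steps occupy disjoint open time intervals. *)
Lemma crossings_le_entry_points gamma theta (c : R) (m : nat) (t : nat -> R) :
  circle theta -> curves gamma ->
  (forall i, (i <= m)%N -> 0 <= t i <= 1) ->
  (forall i, (i < m)%N -> t i <= t i.+1) ->
  ((#|[pred j : 'I_m | between c (dot (gamma (t j)) theta)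
      (dot (gamma (t j.+1)) theta)]|%:R)%:E <=
   counting (entry_points gamma [set z | dot z theta = c]) :> \bar R)%E.
Proof.
move=> th gc t01 tle; rewrite /counting; case: asboolP => fin; last exact: leey.
rewrite lee_fin ler_nat.
set x := fun s => dot (gamma s) theta.
set I := [pred j : 'I_m | _].
have tm i j : (i <= j <= m)%N -> t i <= t j.
  move=> /andP[]; elim: j => [|j IH] ij jm; first by move: ij; rewrite leqn0 => /eqP->.
  move: ij; rewrite leq_eqVlt => /predU1P[->//|ij].
  by rewrite (le_trans _ (tle _ jm))// IH// ltnW.
have ex (j : 'I_m) : exists e, j \in I ->
    t j < e < t j.+1 /\ entry_points gamma [set z | dot z theta = c] e.
  have [jI|jI] := boolP (j \in I); last by exists 0.
  have tj := t01 _ (ltnW (ltn_ord j)); have tj1 := t01 _ (ltn_ord j).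
  have inI s : t j <= s <= t j.+1 -> 0 <= s <= 1.
    by move: tj tj1 => /andP[? ?] /andP[? ?] /andP[? ?]; apply/andP; split; lra.
  have [||e [/andP[te et] xe es]] := @first_passage R x (t j) (t j.+1) c (tle _ (ltn_ord j)).
  - move=> s /inI sI e e0; have [d d0 dP] := curve_dot_continuous th gc sI e0.
    by exists d => // r /inI rI; exact: dP.
  - by move: jI; rewrite inE.
  exists e => _; split; first by rewrite te.
  split => //; first by apply: inI; rewrite !ltW.
  right=> d d0; exists (Num.max (t j) (e - d / 2)).
  have me : Num.max (t j) (e - d / 2) < e by rewrite gt_max te ltrBlDr ltrDl divr_gt0.
  have tm' : t j <= Num.max (t j) (e - d / 2) by rewrite le_max lexx.
  split.
  - by rewrite me lt_max andbT ltrD2l ltrN2 ltr_pdivrMr// ltr_pMr// ltr1n orbT.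
  - by apply: inI; rewrite tm' ltW// (lt_trans me).
  - by apply: es; rewrite tm' me.
have [e eP] := choice ex.
pose s := map e (enum I).
have su : uniq s.
  rewrite map_inj_in_uniq ?enum_uniq// => i j; rewrite !mem_enum => iI jI eij.
  have [/andP[i1 i2] _] := eP _ iI; have [/andP[j1 j2] _] := eP _ jI.
  apply: ord_inj; apply/eqP; rewrite eqn_leq; apply/andP; split; rewrite leqNgt; apply/negP => ij.
    have : t j.+1 <= t i by apply: tm; rewrite ij ltnW.
    by rewrite leNgt (lt_trans i1)// eij.
  have : t i.+1 <= t j by apply: tm; rewrite ij ltnW.
  by rewrite leNgt (lt_trans j1)// -eij.
rewrite [leqLHS]cardE -(size_map e) -/s; apply: uniq_leq_size => // r /mapP[j].
rewrite mem_enum => jI ->; rewrite in_fset_set// inE.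
by have [] := eP _ jI.
Qed.

(** The time 0 is an entry point of any line through the initial point; hence
    the inverse [rho gamma] is never infinite. *)
Lemma vf_ge1 gamma : (1 <= vf gamma)%E.
Proof.
have c1 : circle (1 : R[i]) by rewrite /circle /= normr1.
apply: (@le_trans _ _ (counting (entry_points gamma [set z | dot z 1 = dot (gamma 0) 1]))); last first.
  by apply: ereal_sup_ubound; eexists; last reflexivity; exists 1, (dot (gamma 0) 1).
rewrite /counting; case: asboolP => fin; last exact: leey.
rewrite lee_fin ler1n lt0n cardfs_eq0; apply/eqP => E0.
have : 0 \in fset_set (entry_points gamma [set z | dot z 1 = dot (gamma 0) 1]).
  by rewrite in_fset_set// inE; split => //=; [rewrite lexx ler01|left].
by rewrite E0 inE.
Qed.

Lemma rho_ge0 gamma : (0 <= rho gamma)%E.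
Proof. by rewrite /rho inve_ge0 (le_trans _ (vf_ge1 gamma)). Qed.

Definition plane_fun theta (F : R -> R) : sigma -> R[i] :=
  fun z => (F (dot (val z) theta))%:C.

Definition monotone_on (D : set R) (F : R -> R) (V : R) :=
  forall u v, D u -> D v -> u <= v -> 0 <= F v - F u <= V.

(** The lines counted are the level lines of the coordinate, so the variation
    factor of the curve bounds the number of crossings of every level. *)
Lemma var_plane_fun_le theta F (D : set R) V : circle theta ->
  (forall z, sigma z -> D (dot z theta)) -> 0 <= V -> monotone_on D F V ->
  (var (plane_fun theta F) <= V%:E)%E.
Proof.
move=> th sD V0 FV; apply: ge_ereal_sup => _ [gamma gc <-].
have := vf_ge1 gamma; rewrite /rho.
case vfE : (vf gamma) => [N| |]; rewrite ?leeNy_eq//; last first.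
  by move=> _; rewrite invey mul0e lee_fin.
rewrite lee_fin => N1; have N0 : 0 < N by rewrite (lt_le_trans ltr01).
rewrite inver gt_eqF// lee_pdivrMl// -EFinM.
apply: ge_ereal_sup => _ [n [t [s [st tle ->]]]]; rewrite lee_fin.
case: n st tle => [|m] st tle; first by rewrite big_ord0 mulr_ge0// ltW.
rewrite /=; pose x i := dot (gamma (t i)) theta.
have sx i : (i <= m)%N -> dot (val (s i)) theta = x i by move=> im; rewrite (st i im).2.
rewrite (eq_bigr (fun i : 'I_m => `|F (x i.+1) - F (x i)|)); last first.
  move=> i _; rewrite /plane_fun -rmorphB /= rnorm_real !sx//; exact: ltnW.
apply: (monotone_sum_le (D := D)) => //; last 1 first.
- move=> c; rewrite -lee_fin -vfE.
  apply: le_trans (crossings_le_entry_points c th gc (fun i im => (st i im).1) tle) _.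
  by apply: ereal_sup_ubound; eexists; last reflexivity; exists theta, c.
- by move=> i im; rewrite -sx//; apply: sD; exact: (set_valP (s i)).
- exact: ltW.
Qed.

Hypothesis sigma_neq0 : sigma !=set0.

Let sigma_pt : exists z : sigma, True.
Proof. by have [z sz] := sigma_neq0; exists (SigSub (mem_set sz)). Qed.

Lemma cvar_ge0 (f : sigma -> R[i]) gamma : (0 <= cvar f gamma)%E.
Proof.
have [z _] := sigma_pt.
apply: ereal_sup_ubound; exists 0, (fun=> 0), (fun=> z); split => //.
by rewrite big_ord0.
Qed.

Lemma var_ge0 (f : sigma -> R[i]) : (0 <= var f)%E.
Proof.
pose gamma : R -> R[i] := fun=> 0.
have h : curves gamma by apply: continuous_subspaceT => x; exact: cvg_cst.
rewrite (@le_trans _ _ (rho gamma * cvar f gamma)%E)//.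
  by rewrite mule_ge0 ?rho_ge0 ?cvar_ge0.
by apply: ereal_sup_ubound; exists gamma.
Qed.

Lemma supnorm_ge0 (f : sigma -> R[i]) : (0 <= supnorm f)%E.
Proof.
have [z _] := sigma_pt.
rewrite (@le_trans _ _ (rnorm (f z))%:E)//; first by rewrite lee_fin rnorm_ge0.
by apply: ereal_sup_ubound; exists z.
Qed.

Lemma bvnorm_ge0 (f : sigma -> R[i]) : (0 <= bvnorm f)%E.
Proof. by rewrite adde_ge0 ?supnorm_ge0 ?var_ge0. Qed.

Lemma cvarD (f g : sigma -> R[i]) gamma :
  (cvar (f + g)%R gamma <= cvar f gamma + cvar g gamma)%E.
Proof.
apply: ge_ereal_sup => _ [n [t [s [st tle ->]]]].
apply: (@le_trans _ _ ((\sum_(i < n.-1) rnorm (f (s i.+1) - f (s i)))%:E +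
                       (\sum_(i < n.-1) rnorm (g (s i.+1) - g (s i)))%:E)%E).
  rewrite -EFinD lee_fin -big_split /=; apply: ler_sum => i _.
  by rewrite opprD addrACA rnormD.
by apply: leeD; apply: ereal_sup_ubound; exists n, t, s.
Qed.

Lemma bvnormD (f g : sigma -> R[i]) :
  (bvnorm (f + g)%R <= bvnorm f + bvnorm g)%E.
Proof.
rewrite /bvnorm addeACA; apply: leeD; apply: ge_ereal_sup.
  move=> _ [z _ <-]; apply: (@le_trans _ _ ((rnorm (f z))%:E + (rnorm (g z))%:E)%E).
    by rewrite -EFinD lee_fin rnormD.
  by apply: leeD; apply: ereal_sup_ubound; exists z.
move=> _ [gamma gc <-].
rewrite (le_trans (lee_wpmul2l (rho_ge0 gamma) (cvarD f g gamma)))//.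
rewrite ge0_muleDr ?cvar_ge0//.
by apply: leeD; apply: ereal_sup_ubound; exists gamma.
Qed.

Lemma bvnormN (f : sigma -> R[i]) : bvnorm (- f) = bvnorm f.
Proof.
have sN z : rnorm ((- f) z) = rnorm (f z) by rewrite -[RHS]rnormN.
have vN z w : rnorm ((- f) z - (- f) w) = rnorm (f z - f w).
  by rewrite -[RHS]rnormN opprD.
rewrite /bvnorm /supnorm /var /cvar; congr (ereal_sup _ + ereal_sup _)%E.
  by apply: eq_imagel => z _; rewrite sN.
apply: eq_imagel => gamma _; congr (_ * ereal_sup _)%E.
apply/seteqP; split => _ [n [t [s [st tle ->]]]]; exists n, t, s; split => //;
  by congr EFin; apply: eq_bigr => i _; rewrite vN.
Qed.

Lemma bvnorm_plane_fun_le theta F (D : set R) B V : circle theta ->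
  (forall z, sigma z -> D (dot z theta)) -> 0 <= V -> monotone_on D F V ->
  (forall t, D t -> `|F t| <= B) ->
  (bvnorm (plane_fun theta F) <= (B + V)%:E)%E.
Proof.
move=> th sD V0 FV FB; rewrite EFinD; apply: leeD; last exact: var_plane_fun_le FV.
apply: ge_ereal_sup => _ [z _ <-]; rewrite lee_fin /plane_fun rnorm_real.
by apply: FB; apply: sD; exact: (set_valP z).
Qed.

End PlaneVariation.

(** * Polynomial approximation of the absolute value in variation *)

Section AbsApprox.
Variable R : realType.
Implicit Types (s t u v : R) (n : nat).

(** Successive approximations of [1 - `|s|], the fixed point of
    [w |-> ((1 - s ^+ 2) + w ^+ 2) / 2]. *)
Fixpoint abs_iter n s : R :=
  if n is n'.+1 then ((1 - s ^+ 2) + abs_iter n' s ^+ 2) / 2 else 0.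

Definition abs_defect n s := 1 - `|s| - abs_iter n s.

Lemma abs_iterN n s : abs_iter n (- s) = abs_iter n s.
Proof. by elim: n => //= n ->; rewrite sqrrN. Qed.

Lemma abs_defectN n s : abs_defect n (- s) = abs_defect n s.
Proof. by rewrite /abs_defect abs_iterN normrN. Qed.

(** Subtract the recursion from the fixed point equation and factor the
    difference of squares: on [[-1, 1]] all factors stay nonnegative and
    nonincreasing in [`|s|], whence [abs_defect_mono].  Monotonicity makes the uniform error
    control the variation as well. *)
Lemma abs_defectS n s :
  abs_defect n.+1 s = abs_defect n s * ((1 - `|s|) + abs_iter n s) / 2.
Proof.
rewrite /abs_defect /=.
have -> : s ^+ 2 = `|s| ^+ 2 by rewrite real_normK// num_real.
by field.
Qed.

Lemma abs_iter_mono n u v : 0 <= u -> u <= v -> v <= 1 ->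
  0 <= abs_iter n v <= abs_iter n u.
Proof.
move=> u0 uv v1; elim: n => [|n /andP[IH1 IH2]] /=; first by rewrite lexx.
by apply/andP; split; nra.
Qed.

Lemma abs_defect_mono n u v : 0 <= u -> u <= v -> v <= 1 ->
  0 <= abs_defect n v <= abs_defect n u.
Proof.
move=> u0 uv v1; have v0 : 0 <= v by rewrite (le_trans u0).
elim: n => [|n IH].
  by rewrite /abs_defect /= (ger0_norm u0) (ger0_norm v0); apply/andP; split; lra.
rewrite !abs_defectS.
have /andP[h1 h2] := abs_iter_mono n u0 uv v1.
have /andP[d1 d2] := IH; rewrite (ger0_norm u0) (ger0_norm v0).
set a := abs_defect n v in d1 d2 *; set b := abs_defect n u in d2 *.
set c := (1 - v + _); set d := (1 - u + _).
have c0 : 0 <= c by rewrite addr_ge0// subr_ge0.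
have cd : c <= d by rewrite lerD// lerB.
rewrite divr_ge0 ?mulr_ge0//= ler_pM2r ?invr_gt0//.
exact: ler_pM.
Qed.

(** At 0 the defect [x] satisfies [x' = x - x ^+ 2 / 2]. *)
Lemma abs_defect0_le n : abs_defect n 0 <= 2 / (n%:R + 2).
Proof.
elim: n => [|n IH]; first by rewrite /abs_defect normr0 /= !subr0 add0r divff.
have /andP[d0 _] := @abs_defect_mono n 0 0 (lexx _) (lexx _) ler01.
have d1 : abs_defect n 0 <= 1.
  have /andP[h _] := @abs_iter_mono n 0 0 (lexx _) (lexx _) ler01.
  by rewrite /abs_defect normr0 subr0 gerBl.
rewrite abs_defectS normr0.
have -> : 1 - 0 + abs_iter n 0 = 2 - abs_defect n 0 by rewrite /abs_defect normr0; ring.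
set x := abs_defect n 0 in IH d0 d1 *.
rewrite -[n.+1%:R]natr1; set k : R := n%:R in IH *.
have k0 : 0 <= k by rewrite ler0n.
have k2 : 0 < k + 2 by lra.
have k3 : 0 < k + 1 + 2 by lra.
rewrite ler_pdivlMr//; move: IH; rewrite ler_pdivlMr// => IH.
nra.
Qed.

End AbsApprox.

(** * Functions of one linear coordinate in AC *)

Section AC.
Variables (R : realType) (sigma : set R[i]).
Implicit Types (f g : sigma -> R[i]) (theta : R[i]) (F G : R -> R).

Lemma AC_one : ACfun (1 : sigma -> R[i]).
Proof. by move=> A [_ A1 _ _]. Qed.

Lemma AC_lambda : ACfun (@lambda R sigma).
Proof. by move=> A [_ _ Al _]. Qed.

Lemma AC_add f g : ACfun f -> ACfun g -> ACfun (f + g).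
Proof.
move=> fA gA A AP; have [[_ Aring _ _] _ _ _] := AP.
by have [? ?] := Aring f g (fA A AP) (gA A AP).
Qed.

Lemma AC_mul f g : ACfun f -> ACfun g -> ACfun (f * g).
Proof.
move=> fA gA A AP; have [[_ Aring _ _] _ _ _] := AP.
by have [? ?] := Aring f g (fA A AP) (gA A AP).
Qed.

Lemma AC_scale (c : R[i]) f : ACfun f -> ACfun (c *: f).
Proof.
by move=> fA A AP; have [[_ _ AZ _] _ _ _] := AP; apply: AZ; exact: fA.
Qed.

Lemma AC_closed f : BVfun f ->
  (forall e : R, 0 < e -> exists2 g, ACfun g & (bvnorm (f - g)%R < e%:E)%E) ->
  ACfun f.
Proof.
move=> fBV fA A AP; have [[_ _ _ Acl] _ _ _] := AP.
by apply: Acl => // e /fA[g gA fg]; exists g => //; exact: gA.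
Qed.

Lemma AC_plane_cst theta (c : R) : ACfun (plane_fun theta (fun=> c) : sigma -> R[i]).
Proof.
have -> : plane_fun theta (fun=> c) = c%:C *: (1 : sigma -> R[i]).
  by apply/funext => z; rewrite /plane_fun fctE; rewrite [RHS]mulr1.
by apply: AC_scale; exact: AC_one.
Qed.

Lemma AC_plane_id theta : ACfun (plane_fun theta id : sigma -> R[i]).
Proof.
have -> : plane_fun theta id =
    (2^-1%:C * theta^*%C) *: @lambda R sigma + (2^-1%:C * theta) *: @lambda_bar R sigma.
  have dotE (w : R[i]) :
      (dot w theta)%:C = 2^-1%:C * theta^*%C * w + 2^-1%:C * theta * w^*%C.
    case: theta w => [c d] [a b]; rewrite /dot /=; simpc.
    by apply/eqP; rewrite eq_complex /=; apply/andP; split; apply/eqP; field.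
  by apply/funext => z; exact: dotE.
apply: AC_add; apply: AC_scale; first exact: AC_lambda.
by move=> A [_ _ _].
Qed.

Lemma AC_planeD theta F G : ACfun (plane_fun theta F : sigma -> R[i]) ->
  ACfun (plane_fun theta G : sigma -> R[i]) ->
  ACfun (plane_fun theta (fun t => F t + G t) : sigma -> R[i]).
Proof.
move=> FA GA; have -> : plane_fun theta (fun t => F t + G t) =
    plane_fun theta F + plane_fun theta G :> (sigma -> R[i]).
  by apply/funext => z; rewrite /plane_fun rmorphD.
exact: AC_add.
Qed.

Lemma AC_planeM theta F G : ACfun (plane_fun theta F : sigma -> R[i]) ->
  ACfun (plane_fun theta G : sigma -> R[i]) ->
  ACfun (plane_fun theta (fun t => F t * G t) : sigma -> R[i]).
Proof.
move=> FA GA; have -> : plane_fun theta (fun t => F t * G t) =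
    plane_fun theta F * plane_fun theta G :> (sigma -> R[i]).
  by apply/funext => z; rewrite /plane_fun rmorphM.
exact: AC_mul.
Qed.

Lemma AC_planeZ theta (c : R) F : ACfun (plane_fun theta F : sigma -> R[i]) ->
  ACfun (plane_fun theta (fun t => c * F t) : sigma -> R[i]).
Proof. by move=> FA; apply: AC_planeM => //; exact: AC_plane_cst. Qed.

Lemma AC_abs_iter theta (n : nat) F : ACfun (plane_fun theta F : sigma -> R[i]) ->
  ACfun (plane_fun theta (fun t => abs_iter n (F t)) : sigma -> R[i]).
Proof.
move=> FA; elim: n => [|n IH] /=; first exact: AC_plane_cst.
have -> : (fun t => ((1 - F t ^+ 2) + abs_iter n (F t) ^+ 2) / 2) =
  (fun t => 2^-1 * ((1 + (-1) * (F t * F t)) + abs_iter n (F t) * abs_iter n (F t))).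
  by apply/funext => t; rewrite mulrC !expr2 mulN1r.
apply: AC_planeZ; apply: AC_planeD; last exact: AC_planeM.
by apply: AC_planeD; [exact: AC_plane_cst|apply: AC_planeZ; exact: AC_planeM].
Qed.

Hypothesis sigma_neq0 : sigma !=set0.

(** Used with monotone [F1] and [F2]: the estimates on variation need a
    monotone profile. *)
Lemma plane_fun_split theta F F1 F2 (a b : \bar R) :
  (forall z, sigma z -> F (dot z theta) = F1 (dot z theta) - F2 (dot z theta)) ->
  (bvnorm (plane_fun theta F1 : sigma -> R[i]) <= a)%E ->
  (bvnorm (plane_fun theta F2 : sigma -> R[i]) <= b)%E ->
  (bvnorm (plane_fun theta F : sigma -> R[i]) <= a + b)%E.
Proof.
move=> FE Fa Fb; have -> : plane_fun theta F =
    plane_fun theta F1 + - plane_fun theta F2 :> (sigma -> R[i]).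
  apply/funext => z; rewrite /plane_fun FE ?rmorphB//.
  exact: (set_valP z).
by rewrite (le_trans (bvnormD sigma_neq0 _ _))// bvnormN leeD.
Qed.

(** After rescaling to [[-1, 1]] the error of [abs_iter n] is even and monotone
    on each half-line, so it splits into two monotone functions, of the
    positive and of the negative part of the argument, each with oscillation at
    most the defect at 0. *)
Lemma AC_plane_abs theta (c : R) (M : R) : circle theta ->
  (forall z, sigma z -> `|dot z theta - c| <= M) ->
  ACfun (plane_fun theta (fun t => `|t - c|) : sigma -> R[i]).
Proof.
move=> th sM; have [z0 sz0] := sigma_neq0.
wlog M0 : M sM / 0 < M.
  move=> h; apply: (h (M + 1)); first by move=> z /sM /le_trans; apply; rewrite lerDl.
  by rewrite ltr_wpDl// (le_trans _ (sM _ sz0)).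
pose s (t : R) := (t - c) / M.
have sA : ACfun (plane_fun theta s : sigma -> R[i]).
  have -> : s = (fun t => M^-1 * (id t + - c)) by apply/funext => t; rewrite mulrC.
  by apply: AC_planeZ; apply: AC_planeD; [exact: AC_plane_id|exact: AC_plane_cst].
pose D := [set t | `|s t| <= 1].
have sD z : sigma z -> D (dot z theta).
  by move=> /sM h; rewrite /D /= normrM normfV (gtr0_norm M0) ler_pdivrMr// mul1r.
have s_mono (u v : R) : u <= v -> s u <= s v.
  by move=> uv; rewrite ler_pM2r ?invr_gt0// lerB.
pose pos t := Num.max (s t) 0; pose neg t := Num.max (- s t) 0.
have posD u : D u -> 0 <= pos u <= 1.
  by rewrite /D /= ler_norml le_max lexx orbT ge_max ler01 => /andP[_ ->].
have negD u : D u -> 0 <= neg u <= 1.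
  by rewrite /D /= ler_norml le_max lexx orbT ge_max ler01 andbT lerNl => /andP[->].
have pos_mono (u v : R) : u <= v -> pos u <= pos v.
  by move=> uv; rewrite /pos ge_max !le_max lexx orbT s_mono.
have neg_mono (u v : R) : u <= v -> neg v <= neg u.
  by move=> uv; rewrite /neg ge_max !le_max lexx orbT lerN2 s_mono.
have D0 n (u : R) : 0 <= u <= 1 -> 0 <= abs_defect n u <= abs_defect n 0.
  by move=> /andP[u0 u1]; have := @abs_defect_mono R n 0 u (lexx _) u0 u1.
have abs_split (G : R -> R) (t : R) : (forall r, G (- r) = G r) -> G (s t) = G (pos t) + G (neg t) - G 0.
  move=> GN; rewrite /pos /neg; have [st|st] := leP (s t) 0.
    rewrite max_l ?oppr_ge0// GN; ring.
  rewrite max_r ?oppr_le0 1?ltW//; ring.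
have suffabs : ACfun (plane_fun theta (fun t => `|s t|) : sigma -> R[i]).
  apply: AC_closed => [|e e0].
    apply: (@le_lt_trans _ _ ((1 + 1)%:E + (1 + 1)%:E)%E); last by rewrite -EFinD ltry.
    apply: (@plane_fun_split theta _ pos (fun t => - neg t)).
    - by move=> z sz; rewrite opprK (abs_split (fun r => `|r|)) ?normr0 ?subr0;
        [rewrite !ger0_norm// ?(andP (posD _ (sD _ sz))).1 ?(andP (negD _ (sD _ sz))).1
        |exact: normrN].
    - apply: (@bvnorm_plane_fun_le _ _ _ _ D) => //.
        move=> u v /posD/andP[u0 u1] /posD/andP[v0 v1] /pos_mono uv.
        by apply/andP; split; lra.
      by move=> t /posD/andP[t0 t1]; rewrite ger0_norm.
    - apply: (@bvnorm_plane_fun_le _ _ _ _ D) => //.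
        move=> u v /negD/andP[u0 u1] /negD/andP[v0 v1] /neg_mono uv.
        by apply/andP; split; lra.
      by move=> t /negD/andP[t0 t1]; rewrite normrN ger0_norm.
  have [n ne] : exists n : nat, abs_defect n 0 < e / 4.
    have [n nP] : exists n : nat, 8 / e < n%:R + 2.
      exists (Num.truncn (8 / e)).+1; rewrite ltr_wpDr// truncnS_gt//.
    exists n; apply: (le_lt_trans (abs_defect0_le R n)).
    rewrite ltr_pdivrMr; last by rewrite ltr_wpDl.
    by move: nP; rewrite ltr_pdivrMr// => nP; lra.
  exists (plane_fun theta (fun t => 1 - abs_iter n (s t))).
    have -> : (fun t => 1 - abs_iter n (s t)) = (fun t => 1 + (-1) * abs_iter n (s t)).
      by apply/funext => t; rewrite mulN1r.
    by apply: AC_planeD; [exact: AC_plane_cst|apply: AC_planeZ; exact: AC_abs_iter].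
  set d0 := abs_defect n 0 in ne.
  have -> : plane_fun theta (fun t => `|s t|) - plane_fun theta (fun t => 1 - abs_iter n (s t)) =
      plane_fun theta (fun t => - abs_defect n (s t)) :> (sigma -> R[i]).
    apply/funext => z; set t := dot (val z) theta.
    have tE : - abs_defect n (s t) = `|s t| - (1 - abs_iter n (s t)).
      by rewrite /abs_defect; ring.
    by rewrite /plane_fun -/t tE rmorphB.
  apply: (@le_lt_trans _ _ ((d0 + d0)%:E + (d0 + d0)%:E)%E); last first.
    by rewrite -EFinD lte_fin; lra.
  have /andP[d00 _] := @abs_defect_mono R n 0 0 (lexx _) (lexx _) ler01.
  rewrite -/d0 in d00.
  apply: (@plane_fun_split theta _ (fun t => - abs_defect n (pos t)) (fun t => abs_defect n (neg t) - d0)).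
  - move=> z sz; rewrite (abs_split (abs_defect n)); last exact: abs_defectN.
    by rewrite -/d0; ring.
  - apply: (@bvnorm_plane_fun_le _ _ _ _ D) => //.
      move=> u v Du Dv uv.
      have /andP[u0 u1] := D0 n _ (posD _ Du); have /andP[v0 v1] := D0 n _ (posD _ Dv).
      have /andP[h1 h2] := abs_defect_mono n (andP (posD _ Du)).1 (pos_mono _ _ uv) (andP (posD _ Dv)).2.
      by apply/andP; split; rewrite -/d0 in u1 v1; lra.
    by move=> t Dt; have /andP[t0 t1] := D0 n _ (posD _ Dt); rewrite normrN ger0_norm.
  - apply: (@bvnorm_plane_fun_le _ _ _ _ D) => //.
      move=> u v Du Dv uv.
      have /andP[u0 u1] := D0 n _ (negD _ Du); have /andP[v0 v1] := D0 n _ (negD _ Dv).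
      have /andP[h1 h2] := abs_defect_mono n (andP (negD _ Dv)).1 (neg_mono _ _ uv) (andP (negD _ Du)).2.
      by apply/andP; split; rewrite -/d0 in u1 v1; lra.
    move=> t Dt; have /andP[t0 t1] := D0 n _ (negD _ Dt); rewrite -/d0 in t1.
    by rewrite ler0_norm; lra.
have -> : (fun t => `|t - c|) = (fun t => M * `|s t|).
  by apply/funext => t; rewrite /s normrM normfV (gtr0_norm M0) mulrC divfK// gt_eqF.
exact: AC_planeZ.
Qed.

End AC.

(** * Ramps *)

Section Ramp.
Variable R : realType.
Implicit Types (mu nu t d : R).

(** A ramp is a combination of two absolute values and a constant, hence lies
    in AC as soon as absolute values do. *)
Lemma ramp_abs mu d t : 0 < d ->
  ramp mu d t = 1 + (- (2 * d)^-1) * ((`|t - mu| + (-1) * `|t - (mu + d)|) + d).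
Proof.
move=> d0; rewrite /ramp; case: ifPn => [tm|]; last rewrite -ltNge => mt.
  rewrite ler0_norm ?subr_le0// ler0_norm ?subr_le0; last lra.
  by field; rewrite gt_eqF.
case: ifPn => [dt|]; last rewrite -ltNge => td.
  rewrite ger0_norm ?subr_ge0 1?ltW// ger0_norm ?subr_ge0//.
  by field; rewrite gt_eqF.
rewrite gtr0_norm ?subr_gt0// ltr0_norm ?subr_lt0//.
by field; rewrite gt_eqF.
Qed.

Lemma ramp_le mu d t : t <= mu -> ramp mu d t = 1.
Proof. by rewrite /ramp => ->. Qed.

Lemma ramp_ge mu d t : 0 < d -> mu + d <= t -> ramp mu d t = 0.
Proof. by move=> d0 h; rewrite /ramp h leNgt (lt_le_trans _ h)// ltrDl. Qed.

Lemma ramp_mid mu d t : 0 < d -> mu <= t <= mu + d ->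
  ramp mu d t = (mu + d - t) / d.
Proof.
move=> d0 /andP[mt tm]; rewrite /ramp; case: ifPn => [tm'|_].
  have -> : t = mu by apply/eqP; rewrite eq_le tm'.
  by rewrite addrAC subrr add0r divff// gt_eqF.
by case: ifPn => // h; rewrite (@le_anti _ _ t (mu + d)) ?tm// subrr mul0r.
Qed.

Lemma ramp01 mu d t : 0 < d -> 0 <= ramp mu d t <= 1.
Proof.
move=> d0; have [h|h] := leP t mu; first by rewrite ramp_le// ler01 lexx.
have [h'|h'] := leP (mu + d) t; first by rewrite ramp_ge// ler01 lexx.
have hm : mu <= t <= mu + d by rewrite !ltW.
rewrite ramp_mid//; apply/andP; split; first by rewrite divr_ge0; lra.
by rewrite ler_pdivrMr// mul1r; lra.
Qed.

Lemma ramp_mono mu d t u : 0 < d -> t <= u -> ramp mu d u <= ramp mu d t.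
Proof.
move=> d0 tu; have /andP[r0 r1] := ramp01 mu t d0; have /andP[s0 s1] := ramp01 mu u d0.
have [h|h] := leP t mu; first by rewrite (ramp_le _ h).
have [h'|h'] := leP (mu + d) u; first by rewrite (ramp_ge d0 h').
rewrite !ramp_mid//; last 2 first.
- by apply/andP; split; lra.
- by apply/andP; split; lra.
by rewrite ler_pM2r ?invr_gt0//; lra.
Qed.

Lemma ramp_lipschitz mu d t : 0 < d -> mu <= t -> 1 - ramp mu d t <= (t - mu) / d.
Proof.
move=> d0 mt; have [h'|h'] := leP (mu + d) t.
  by rewrite (ramp_ge d0 h') subr0 ler_pdivlMr//; lra.
have hm : mu <= t <= mu + d by rewrite mt ltW.
rewrite ramp_mid//; have -> : 1 - (mu + d - t) / d = (t - mu) / d by field; rewrite gt_eqF.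
exact: lexx.
Qed.

(** The right ramp equals 1 wherever the left one is nonzero. *)
Lemma ramp_absorb mu nu d d' t : 0 < d -> mu + d <= nu ->
  ramp mu d t * ramp nu d' t = ramp mu d t.
Proof.
move=> d0 h; have [tn|tn] := leP t nu; first by rewrite (ramp_le d' tn) mulr1.
by rewrite ramp_ge ?mul0r// (le_trans h)// ltW.
Qed.

Lemma ramp_reflect mu d t : 0 < d -> ramp (- mu) d (- t) = 1 - ramp (mu - d) d t.
Proof.
move=> d0; have [h|h] := leP t (mu - d).
  rewrite (ramp_le _ h) subrr ramp_ge//; lra.
have [h'|h'] := leP mu t.
  rewrite ramp_le ?lerN2// ramp_ge ?subr0//; lra.
rewrite !ramp_mid//; last 2 first.
- by apply/andP; split; lra.
- by apply/andP; split; lra.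
by field; rewrite gt_eqF.
Qed.

End Ramp.

Section RampAC.
Variables (R : realType) (sigma : set R[i]).
Hypothesis sigma_neq0 : sigma !=set0.
Implicit Types (theta : R[i]) (mu nu d : R).

Lemma compact_rnorm_le : compact sigma ->
  exists M : R, forall z, sigma z -> rnorm z <= M.
Proof.
move=> sc; pose n (z : R[i]) : R := rnorm z.
have nc (z : R[i]) : n w @[w --> z] --> n z.
  apply/(@cvgrPdist_lt R R R[i] (nbhs z) (nbhs_filter z)) => e e0.
  have /(@cvg_rnormP R _ _ (nbhs_filter z) R[i] id z)/(_ e e0) : id @ nbhs z --> z by exact: cvg_id.
  apply: filterS => w; apply: le_lt_trans; rewrite /n ler_norml; apply/andP; split.
    by have := rnorm_triangle z w 0; rewrite !subr0 [rnorm (w - z)]rnormB; lra.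
  by have := rnorm_triangle w z 0; rewrite !subr0; lra.
have : compact (n @` sigma).
  by apply: continuous_compact => //; exact: continuous_subspaceT.
move=> /compact_bounded[M [_ MP]]; exists (M + 1) => z sz.
by rewrite (le_trans (ler_norm _))// MP ?ltrDl//; exists z.
Qed.

Hypothesis sigma_compact : compact sigma.

Lemma AC_ramp theta mu d : circle theta -> 0 < d ->
  ACfun (@half_plane_ramp R sigma theta mu d).
Proof.
move=> th d0; have [M MP] := compact_rnorm_le sigma_compact.
have absAC c : ACfun (plane_fun theta (fun t => `|t - c|) : sigma -> R[i]).
  apply: (@AC_plane_abs _ _ sigma_neq0 _ _ (M + `|c|)) => // z sz.
  by rewrite (le_trans (ler_normB _ _))// lerD2r (le_trans (dot_norm_le _ th))// MP.
have -> : half_plane_ramp theta mu d = plane_fun theta (fun t =>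
    1 + (- (2 * d)^-1) * ((`|t - mu| + (-1) * `|t - (mu + d)|) + d)) :> (sigma -> R[i]).
  by apply/funext => z; rewrite /half_plane_ramp /plane_fun ramp_abs.
apply: AC_planeD; first exact: AC_plane_cst.
apply: AC_planeZ; apply: AC_planeD; last exact: AC_plane_cst.
by apply: AC_planeD; [exact: absAC|apply: AC_planeZ; exact: absAC].
Qed.

Lemma bvnorm_plane_funN theta (F : R -> R) :
  bvnorm (plane_fun theta (fun t => - F t) : sigma -> R[i]) = bvnorm (plane_fun theta F : sigma -> R[i]).
Proof.
rewrite -bvnormN; congr bvnorm; apply/funext => z.
by rewrite /plane_fun -[LHS]/(- _%:C) rmorphN opprK.
Qed.

Lemma bvnorm_ramp_le theta (c : R) mu d : circle theta -> 0 < d -> 0 <= c ->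
  (bvnorm (plane_fun theta (fun t => (c * ramp mu d t)%R) : sigma -> R[i]) <= (c + c)%:E)%E.
Proof.
move=> th d0 c0; rewrite -bvnorm_plane_funN.
apply: (@bvnorm_plane_fun_le _ _ _ _ setT) => //.
  move=> u v _ _ uv; have /andP[a0 a1] := ramp01 mu u d0.
  have /andP[b0 b1] := ramp01 mu v d0; have := ramp_mono mu d0 uv => ab.
  by apply/andP; split; nra.
move=> t _; have /andP[a0 a1] := ramp01 mu t d0.
by rewrite normrN ger0_norm ?mulr_ge0// ler_piMr.
Qed.

(** Since [g] vanishes beyond [b], replace [k] by its truncation [K] at [b];
    then [g * K = K - (1 - g) * K] is a difference of two nondecreasing
    functions with values in [[0, k b]]. *)
Lemma bvnorm_cutoff_le theta (g k : R -> R) (b : R) : circle theta ->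
  (forall t, 0 <= g t <= 1) -> (forall t u, t <= u -> g u <= g t) ->
  (forall t, b <= t -> g t = 0) ->
  (forall t, 0 <= k t) -> (forall t u, t <= u -> k t <= k u) ->
  (bvnorm (plane_fun theta (fun t => (g t * k t)%R) : sigma -> R[i]) <= (4 * k b)%:E)%E.
Proof.
move=> th g01 gmono gb k0 kmono.
pose K t := k (Num.min t b).
have K0 t : 0 <= K t <= k b by rewrite k0 kmono// ge_min lexx orbT.
have Kmono t u : t <= u -> K t <= K u.
  by move=> tu; apply: kmono; rewrite le_min !ge_min tu lexx orbT.
have -> : (4 * k b)%:E = ((k b + k b)%:E + (k b + k b)%:E)%E.
  by rewrite -EFinD; congr EFin; ring.
apply: (@plane_fun_split _ _ sigma_neq0 _ _ K (fun t => (1 - g t) * K t)).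
- move=> z _; rewrite /K; have [h|h] := leP (dot z theta) b; first by ring.
  by rewrite gb ?ltW//; ring.
- apply: (@bvnorm_plane_fun_le _ _ _ _ setT) => //.
    move=> u v _ _ uv; have /andP[? ?] := K0 u; have /andP[? ?] := K0 v.
    by have := Kmono _ _ uv => ?; apply/andP; split; lra.
  by move=> t _; have /andP[? ?] := K0 t; rewrite ger0_norm.
- apply: (@bvnorm_plane_fun_le _ _ _ _ setT) => //.
    move=> u v _ _ uv; have /andP[? ?] := K0 u; have /andP[? ?] := K0 v.
    have /andP[? ?] := g01 u; have /andP[? ?] := g01 v.
    have := Kmono _ _ uv => ?; have := gmono _ _ uv => ?.
    have h1 : (1 - g u) * K u <= (1 - g v) * K v by apply: ler_pM; lra.
    have h2 : (1 - g v) * K v <= 1 * k b by apply: ler_pM; lra.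
    have h3 : 0 <= (1 - g u) * K u by apply: mulr_ge0; lra.
    by apply/andP; split; lra.
  move=> t _; have /andP[? ?] := K0 t; have /andP[? ?] := g01 t.
  have h2 : (1 - g t) * K t <= 1 * k b by apply: ler_pM; lra.
  have h3 : 0 <= (1 - g t) * K t by apply: mulr_ge0; lra.
  by rewrite ger0_norm//; lra.
Qed.

(** The second factor is small where the first one is not zero. *)
Lemma bvnorm_ramp_diff_le theta mu nu d d' : circle theta -> 0 < d -> 0 < d' -> mu <= nu ->
  (bvnorm (half_plane_ramp theta nu d' * (1 - half_plane_ramp theta mu d) : sigma -> R[i])%R
     <= (4 * ((nu + d' - mu) / d))%:E)%E.
Proof.
move=> th d0 d'0 mn.
have -> : (half_plane_ramp theta nu d' * (1 - half_plane_ramp theta mu d))%R =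
    plane_fun theta (fun t => ramp nu d' t * (1 - ramp mu d t)) :> (sigma -> R[i]).
  by apply/funext => z; rewrite /plane_fun rmorphM rmorphB.
apply: (@le_trans _ _ (4 * (1 - ramp mu d (nu + d')))%:E).
  apply: (@bvnorm_cutoff_le theta (ramp nu d') (fun t => 1 - ramp mu d t) (nu + d')) => //.
  - by move=> t; exact: ramp01.
  - by move=> t u; exact: ramp_mono.
  - by move=> t; exact: ramp_ge.
  - by move=> t; rewrite subr_ge0; have /andP[] := ramp01 mu t d0.
  - by move=> t u tu; rewrite lerB// ramp_mono.
rewrite lee_fin ler_wpM2l// ramp_lipschitz//.
by rewrite (le_trans mn)// lerDl ltW.
Qed.

End RampAC.

(** * The functional calculus on ramps *)

Section Calculus.
Variables (R : realType) (sigma : set R[i]) (X : completeNormedModType R[i]).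
Variables (T : bounded_op X) (psi : (sigma -> R[i]) -> bounded_op X).
Hypothesis sigma_neq0 : sigma !=set0.
Hypothesis sigma_compact : compact sigma.
Hypothesis calc : is_functional_calculus psi T.
Implicit Types (theta : R[i]) (mu nu d : R) (f g : sigma -> R[i]) (x : X).

Lemma calcD f g x : ACfun f -> ACfun g -> psi (f + g) x = psi f x + psi g x.
Proof. by case: calc => + _ _ _ _; apply. Qed.

Lemma calcZ c f x : ACfun f -> psi (c *: f) x = c *: psi f x.
Proof. by case: calc => _ + _ _ _; apply. Qed.

Lemma calcM f g x : ACfun f -> ACfun g -> psi (f * g) x = psi f (psi g x).
Proof. by case: calc => _ _ + _ _; apply. Qed.

Lemma calc1 x : psi 1 x = x.
Proof. by case: calc => _ _ _ + _; apply. Qed.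

Lemma AC_opp f : ACfun f -> ACfun (- f).
Proof.
move=> fA; have -> : - f = (-1) *: f by rewrite scaleN1r.
exact: AC_scale.
Qed.

Lemma calcN f x : ACfun f -> psi (- f) x = - psi f x.
Proof.
move=> fA; have -> : - f = (-1) *: f by rewrite scaleN1r.
by rewrite calcZ// scaleN1r.
Qed.

Lemma AC_sub f g : ACfun f -> ACfun g -> ACfun (f - g).
Proof. by move=> fA gA; apply: AC_add => //; exact: AC_opp. Qed.

Lemma calcB f g x : ACfun f -> ACfun g -> psi (f - g) x = psi f x - psi g x.
Proof. by move=> fA gA; rewrite calcD//; [rewrite calcN|exact: AC_opp]. Qed.

Lemma calc0 x : psi 0 x = 0.
Proof.
have A1 : ACfun (1 : sigma -> R[i]) by exact: AC_one.
by rewrite -[0](subrr (1 : sigma -> R[i])) calcB// subrr.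
Qed.

Lemma calcC f g x : ACfun f -> ACfun g -> psi f (psi g x) = psi g (psi f x).
Proof. by move=> fA gA; rewrite -!calcM// mulrC. Qed.

Lemma calc_bounded : exists2 K : R, 0 <= K & forall f b x, ACfun f -> 0 <= b ->
  (bvnorm f <= b%:E)%E -> rnorm (psi f x) <= K * b * rnorm x.
Proof.
have [_ _ _ _ [[K KP] _]] := calc.
have K0 : 0 <= Num.max K 0 by rewrite le_max lexx orbT.
exists (Num.max K 0) => // f b x fA b0 fb.
apply: le_opnorm; apply: (le_trans (KP _ fA)).
rewrite (@le_trans _ _ ((Num.max K 0)%:E * bvnorm f)%E)//.
  by rewrite lee_wpmul2r ?bvnorm_ge0// lee_fin le_max lexx.
by rewrite EFinM lee_wpmul2l.
Qed.

Local Notation h := (@half_plane_ramp R sigma).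

Let hA := AC_ramp sigma_neq0 sigma_compact.

(** Both estimates needed on ramps, with a common constant, in operator form. *)
Lemma calc_ramp_bounded : exists2 K : R, 0 <= K &
  (forall theta mu d x, circle theta -> 0 < d ->
     rnorm (psi (h theta mu d) x) <= K * rnorm x) /\
  (forall theta mu nu d d' x, circle theta -> 0 < d -> 0 < d' -> mu <= nu ->
     rnorm (psi (h theta nu d') (x - psi (h theta mu d) x)) <=
       K * ((nu + d' - mu) / d) * rnorm x).
Proof.
have [K K0 KP] := calc_bounded.
exists (K * 4); first by rewrite mulr_ge0.
split=> [theta mu d x th d0|theta mu nu d d' x th d0 d'0 mn].
  apply: KP => //; first exact: hA.
  have := @bvnorm_ramp_le R sigma theta 1 mu d th d0 ler01.
  under [in plane_fun _ _]eq_fun do rewrite mul1r.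
  by move=> /le_trans; apply; rewrite lee_fin; lra.
have -> : psi (h theta nu d') (x - psi (h theta mu d) x) =
    psi (h theta nu d' * (1 - h theta mu d)) x.
  rewrite calcM; [|exact: hA|by apply: AC_sub; [exact: AC_one|exact: hA]].
  by rewrite calcB; [rewrite calc1|exact: AC_one|exact: hA].
rewrite -(mulrA K); apply: KP.
- apply: AC_mul; first exact: hA.
  by apply: AC_sub; [exact: AC_one|exact: hA].
- by rewrite mulr_ge0// divr_ge0 ?ltW//; lra.
- exact: bvnorm_ramp_diff_le.
Qed.

(** Asymptotic form of [ramp_absorb] for two ramps that start at the same
    level; the exact identity fails there. *)
Lemma calc_ramp_asymptotic theta mu s x : circle theta -> 0 < s ->
  psi (h theta mu d) (x - psi (h theta mu s) x) @[d --> 0^'+] --> (0 : X).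
Proof.
move=> th s0; have [K K0 [_ KP]] := calc_ramp_bounded.
apply/cvg_rnormP => e e0; pose c := s * e / (K * rnorm x + 1).
have Kx : 0 < K * rnorm x + 1 by rewrite ltr_wpDl// mulr_ge0// rnorm_ge0.
have c0 : 0 < c by rewrite divr_gt0// mulr_gt0.
near=> d.
have d0 : 0 < d by near: d; exact: nbhs_right_gt.
have dc : d < c by near: d; exact: nbhs_right_lt.
rewrite sub0r rnormN (le_lt_trans (KP _ _ _ _ _ _ th s0 d0 (lexx _)))//.
rewrite [mu + d]addrC addrK; move: dc; rewrite ltr_pdivlMr// => dc.
have -> : K * (d / s) * rnorm x = d * (K * rnorm x) / s by ring.
rewrite ltr_pdivrMr// [e * s]mulrC.
by rewrite (le_lt_trans _ dc)// ler_wpM2l ?(ltW d0)// lerDl.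
Unshelve. all: by end_near. Qed.

Lemma calc_ramp_cvg theta mu x : is_type_B psi -> circle theta ->
  exists y : X, psi (h theta mu d) x @[d --> 0^'+] --> y.
Proof.
move=> type_B th; have [K K0 [KP _]] := calc_ramp_bounded.
(* Type (B) speaks of the unit ball, while ramps have norm at most 2. *)
have [C CS [cC _]] := type_B (2%:C *: x).
have Ch d : 0 < d -> C (psi (h theta mu d) x).
  move=> d0; apply: CS; exists (2^-1%:C *: h theta mu d).
    split; first by apply: AC_scale; exact: hA.
    have := @bvnorm_ramp_le R sigma theta 2^-1 mu d th d0.
    rewrite invr_ge0 ler0n => /(_ isT).
    have -> : 2^-1 + 2^-1 = 1 :> R by lra.
    have -> : plane_fun theta (fun t => 2^-1 * ramp mu d t) =
        2^-1%:C *: h theta mu d :> (sigma -> R[i]).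
      by apply/funext => z; rewrite /plane_fun rmorphM.
    by [].
  rewrite calcZ; last exact: hA.
  by rewrite linearZ scalerA -rmorphM /= mulVf ?pnatr_eq0// scale1r.
apply: (@mean_ergodic R X R (0^'+) _ [set d | 0 < d] _ K C x) => //.
- exact: nbhs_right_gt.
- by move=> d v d0; exact: KP.
- by move=> s s0; exact: calc_ramp_asymptotic.
- move=> s s0; rewrite -(oppr0 X); apply: cvg_near_eq (cvgN (calc_ramp_asymptotic mu x th s0)).
  apply: filterS (nbhs_right_gt (0 : R)) => d d0.
  transitivity (- psi (h theta mu d) (x - psi (h theta mu s) x)) => //.
  by rewrite linearB opprB calcC//; exact: hA.
Qed.

End Calculus.

(** * The half-plane spectral family *)

Section Family.
Variables (R : realType) (sigma : set R[i]) (X : completeNormedModType R[i]).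
Variables (T : bounded_op X) (psi : (sigma -> R[i]) -> bounded_op X).
Hypothesis sigma_neq0 : sigma !=set0.
Hypothesis sigma_compact : compact sigma.
Hypothesis calc : is_functional_calculus psi T.
Implicit Types (theta : R[i]) (mu nu d : R) (f g : sigma -> R[i]) (x : X).

Local Notation h := (@half_plane_ramp R sigma).
Let hA := AC_ramp sigma_neq0 sigma_compact.

Lemma half_plane_projection_ex theta mu : is_type_B psi -> circle theta ->
  exists B : bounded_op X, forall x, psi (h theta mu d) x @[d --> 0^'+] --> B x.
Proof.
move=> tB th; have [K K0 [KP _]] := calc_ramp_bounded sigma_neq0 sigma_compact calc.
have ex x : exists y : X, psi (h theta mu d) x @[d --> 0^'+] --> y.
  exact: (calc_ramp_cvg sigma_neq0 sigma_compact calc).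
have [L LP] := choice ex.
have [|x|B BL] := @bounded_linear_of R X X L K.
- move=> c u v; apply: rcvg_unique (LP _) _.
  have -> : (fun d => psi (h theta mu d) (c *: u + v)) =
      (fun d => c *: psi (h theta mu d) u + psi (h theta mu d) v).
    by apply/funext => d; rewrite linearP.
  by apply: cvgD; [apply: cvgZr; exact: LP|exact: LP].
- apply: cvg_rnorm_le (LP x) _; apply: filterS (nbhs_right_gt (0 : R)) => d d0.
  exact: KP.
by exists B => x; rewrite BL; exact: LP.
Qed.

Variable E : R[i] -> R -> bounded_op X.
Hypothesis EL : forall theta mu x, circle theta ->
  psi (h theta mu d) x @[d --> 0^'+] --> E theta mu x.

Lemma family_bounded : exists2 K : R, 0 <= K & forall theta mu x, circle theta ->
  rnorm (E theta mu x) <= K * rnorm x.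
Proof.
have [K K0 [KP _]] := calc_ramp_bounded sigma_neq0 sigma_compact calc.
exists K => // theta mu x th; apply: cvg_rnorm_le (@EL theta mu x th) _.
by apply: filterS (nbhs_right_gt (0 : R)) => d d0; exact: KP.
Qed.

(** Every relation below is read off from ramps of small width and transported
    to the limit by this lemma or by [rcvg_unique]. *)
Lemma family_unique theta mu x y : circle theta ->
  (\forall d \near 0^'+, psi (h theta mu d) x = y) -> E theta mu x = y.
Proof.
move=> th hy; apply: rcvg_unique (@EL theta mu x th) _; exact: cvg_near_cst.
Qed.

Lemma family_calcC theta mu f x : circle theta -> ACfun f ->
  E theta mu (psi f x) = psi f (E theta mu x).
Proof.
move=> th fA; apply: rcvg_unique (@EL theta mu _ th) _.
apply: (cvg_near_eq _ (cvg_bounded_linear (psi f) (@EL theta mu x th))).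
apply: filterS (nbhs_right_gt (0 : R)) => d d0.
by rewrite (calcC calc)//; exact: hA.
Qed.

Lemma family_comm theta mu theta' mu' x : circle theta -> circle theta' ->
  E theta mu (E theta' mu' x) = E theta' mu' (E theta mu x).
Proof.
move=> th th'; apply: esym; apply: rcvg_unique (@EL theta' mu' _ th') _.
apply: (cvg_near_eq _ (cvg_bounded_linear (E theta mu) (@EL theta' mu' x th'))).
apply: filterS (nbhs_right_gt (0 : R)) => d d0.
by rewrite family_calcC//; exact: hA.
Qed.

Lemma calc_family_fix theta mu d x : circle theta -> 0 < d ->
  psi (h theta mu d) (E theta mu x) = E theta mu x.
Proof.
move=> th d0; rewrite -family_calcC//; last exact: hA.
apply/eqP; rewrite eq_sym -subr_eq0 -linearB; apply/eqP.
apply: rcvg_unique (@EL theta mu _ th) _.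
exact: (calc_ramp_asymptotic sigma_neq0 sigma_compact calc).
Qed.

Lemma family_proj theta mu x : circle theta ->
  E theta mu (E theta mu x) = E theta mu x.
Proof.
move=> th; apply: family_unique => //.
by apply: filterS (nbhs_right_gt (0 : R)) => d d0; exact: calc_family_fix.
Qed.

Lemma calc_ramp_absorb theta mu nu d d' x : circle theta -> 0 < d -> 0 < d' ->
  mu + d <= nu -> psi (h theta mu d) (psi (h theta nu d') x) = psi (h theta mu d) x.
Proof.
move=> th d0 d'0 mn; rewrite -(calcM calc); [|exact: hA..].
congr (psi _ x); apply/funext => z.
rewrite /half_plane_ramp -[LHS]/(_%:C * _%:C) -rmorphM /=.
by rewrite ramp_absorb.
Qed.

Lemma calc_family_absorb theta mu nu d x : circle theta -> 0 < d ->
  mu + d <= nu -> psi (h theta mu d) (E theta nu x) = psi (h theta mu d) x.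
Proof.
move=> th d0 mn; rewrite -family_calcC//; last exact: hA.
apply: family_unique => //; apply: filterS (nbhs_right_gt (0 : R)) => d' d'0.
by rewrite (calcC calc); [exact: calc_ramp_absorb|exact: hA..].
Qed.

Lemma family_lt theta mu nu x : circle theta -> mu < nu ->
  E theta mu (E theta nu x) = E theta mu x.
Proof.
move=> th mn; apply: rcvg_unique (@EL theta mu _ th) _.
apply: (cvg_near_eq _ (@EL theta mu x th)).
near=> d; have d0 : 0 < d by near: d; exact: nbhs_right_gt.
have dn : d < nu - mu by near: d; apply: nbhs_right_lt; rewrite subr_gt0.
by rewrite calc_family_absorb// -lerBrDl ltW.
Unshelve. all: by end_near. Qed.

Lemma family_min theta mu nu x : circle theta ->
  E theta mu (E theta nu x) = E theta (Num.min mu nu) x.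
Proof.
move=> th; have [mn|nm|->] := ltgtP mu nu; first exact: family_lt.
- by rewrite family_comm// family_lt.
- exact: family_proj.
Qed.

(** Complementation exchanges opposite half-planes: one minus a ramp for
    [theta] is a ramp for [- theta]. *)
Lemma calc_ramp_reflect theta mu d x : circle theta -> 0 < d ->
  psi (h (- theta) (- mu) d) x = x - psi (h theta (mu - d) d) x.
Proof.
move=> th d0.
have -> : h (- theta) (- mu) d = 1 - h theta (mu - d) d.
  apply/funext => z; rewrite /half_plane_ramp dotN ramp_reflect//.
  by rewrite rmorphB.
by rewrite (calcB calc) ?(calc1 calc)//; [exact: AC_one|exact: hA].
Qed.

(** For small widths the reflected ramp of the opposite half-plane is one minus
    a ramp that absorbs the ramp at [mu1], so the product vanishes. *)
Lemma family_opposite theta mu1 mu2 x : circle theta -> mu1 < mu2 ->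
  E theta mu1 (E (- theta) (- mu2) x) = 0.
Proof.
move=> th m12; apply: family_unique => //.
near=> d; have d0 : 0 < d by near: d; exact: nbhs_right_gt.
have dm : d < mu2 - mu1 by near: d; apply: nbhs_right_lt; rewrite subr_gt0.
rewrite -family_calcC; [|exact: circleN|exact: hA].
apply: family_unique; first exact: circleN.
near=> d'; have d'0 : 0 < d' by near: d'; exact: nbhs_right_gt.
have d'm : d' < mu2 - mu1 - d by near: d'; apply: nbhs_right_lt; rewrite subr_gt0.
rewrite calc_ramp_reflect// (calcC calc) ?calc_ramp_absorb ?subrr//; try exact: hA.
lra.
Unshelve. all: by end_near. Qed.

(** Write [E mu x - E nu x] as [E nu] applied to [E mu x - psi h_(mu, d) x],
    small for [d] small, minus [E nu] applied to [x - psi h_(mu, d) x], small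
    for fixed [d] as [nu] decreases to [mu]. *)
Lemma family_right_cvg theta mu x : circle theta ->
  E theta nu x @[nu --> mu^'+] --> E theta mu x.
Proof.
move=> th; have [K K0 EK] := family_bounded.
have [K' K'0 [_ KP]] := calc_ramp_bounded sigma_neq0 sigma_compact calc.
apply/cvg_rnormP => e e0.
have eK : 0 < e / 2 / (K + 1) by rewrite !divr_gt0// ltr_wpDl.
have [d [d0 dP]] : exists d, 0 < d /\ rnorm (E theta mu x - psi (h theta mu d) x) < e / 2 / (K + 1).
  have /cvg_rnormP/(_ _ eK) := @EL theta mu x th.
  by move=> /(filterI (nbhs_right_gt (0 : R)))/filter_ex[d [d0 dP]]; exists d.
pose c := d * (e / 4) / (K' * rnorm x + 1).
have Kx : 0 < K' * rnorm x + 1 by rewrite ltr_wpDl// mulr_ge0// rnorm_ge0.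
have c0 : 0 < c by rewrite divr_gt0// mulr_gt0// divr_gt0.
near=> nu.
have mn : mu < nu by near: nu; exact: nbhs_right_gt.
have nc : nu - mu < c.
  by rewrite ltrBlDl; near: nu; apply: nbhs_right_lt; rewrite ltrDl.
have -> : E theta mu x - E theta nu x =
    E theta nu (E theta mu x - psi (h theta mu d) x) -
    E theta nu (x - psi (h theta mu d) x).
  rewrite !linearB /= family_comm// family_lt//.
  by rewrite opprK addrACA addNr addr0.
rewrite (le_lt_trans (rnormD _ _))// rnormN [e]splitr ltr_leD//.
  rewrite (le_lt_trans (EK _ _ _ th))//.
  move: dP; rewrite ltr_pdivlMr ?ltr_wpDl//; apply: le_lt_trans.
  by rewrite mulrC ler_wpM2l ?rnorm_ge0// lerDl.
apply: cvg_rnorm_le (@EL theta nu _ th) _.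
near=> d'; have d'0 : 0 < d' by near: d'; exact: nbhs_right_gt.
have d'n : d' < nu - mu by near: d'; apply: nbhs_right_lt; rewrite subr_gt0.
rewrite (le_trans (KP _ _ _ _ _ _ th d0 d'0 (ltW mn)))//.
have -> : K' * ((nu + d' - mu) / d) * rnorm x = (nu + d' - mu) * (K' * rnorm x) / d by ring.
rewrite ler_pdivrMr//; move: nc; rewrite ltr_pdivlMr// => nc.
have Kx0 : 0 <= K' * rnorm x by rewrite mulr_ge0// rnorm_ge0.
have : (nu + d' - mu) * (K' * rnorm x) <= 2 * ((nu - mu) * (K' * rnorm x)).
  by rewrite [leRHS]mulrA ler_wpM2r//; lra.
move: nc; rewrite mulrDr; lra.
Unshelve. all: by end_near. Qed.

Lemma family_left_limit theta mu x : circle theta ->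
  psi (h theta (mu - d) d) x @[d --> 0^'+] --> x - E (- theta) (- mu) x.
Proof.
move=> th; apply: (cvg_near_eq _ (cvgB (cvg_cst x) (@EL (- theta) (- mu) x (circleN th)))).
apply: filterS (nbhs_right_gt (0 : R)) => d d0.
transitivity (x - psi (h (- theta) (- mu) d) x) => //.
by rewrite calc_ramp_reflect// opprB addrCA subrr addr0.
Qed.

Lemma family_left_fix theta mu nu x : circle theta -> mu <= nu ->
  E theta nu (x - E (- theta) (- mu) x) = x - E (- theta) (- mu) x.
Proof.
move=> th mn; apply: rcvg_unique (@family_left_limit theta mu x th).
apply: (cvg_near_eq _ (cvg_bounded_linear (E theta nu) (@family_left_limit theta mu x th))).
apply: filterS (nbhs_right_gt (0 : R)) => d d0.
rewrite family_calcC; [|done|exact: hA].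
by rewrite calc_family_absorb// subrK.
Qed.

(** [y := x - E (- theta) (- mu) x] has the same image as [x] under [E nu] for
    [nu < mu], and it is approximated, by right continuity in the direction
    [- theta], by vectors fixed by [E nu] for [nu] close to [mu]. *)
Lemma family_left_cvg theta mu x : circle theta ->
  E theta nu x @[nu --> mu^'-] --> x - E (- theta) (- mu) x.
Proof.
move=> th; have thN := circleN th; have [K K0 EK] := family_bounded.
set y := x - _.
apply/cvg_rnormP => e e0.
have eK : 0 < e / (K + 1) by rewrite divr_gt0// ltr_wpDl.
have [s [ms sP]] : exists s, - mu < s /\ rnorm (E (- theta) (- mu) x - E (- theta) s x) < e / (K + 1).
  have /cvg_rnormP/(_ _ eK) := @family_right_cvg (- theta) (- mu) x thN.
  by move=> /(filterI (nbhs_right_gt (- mu)))/filter_ex[s [ms sP]]; exists s.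
near=> nu.
have nm : nu < mu by near: nu; exact: nbhs_left_lt.
have sn : - s < nu by near: nu; apply: nbhs_left_gt; rewrite ltrNl.
have Ey : E theta nu x = E theta nu y.
  by rewrite linearB family_opposite// subr0.
pose w := x - E (- theta) (- - s) x.
have Ew : E theta nu w = w by apply: family_left_fix => //; exact: ltW.
have yw : rnorm (y - w) < e / (K + 1).
  rewrite /y /w opprK; set a := E _ _ x in sP *; set b := E _ _ x in sP *.
  have -> : x - a - (x - b) = - (a - b).
    by rewrite opprB [b - x]addrC addrACA subrr add0r opprB addrC.
  by rewrite rnormN.
clearbody w y.
have -> : y - E theta nu x = (y - w) - E theta nu (y - w).
  by rewrite Ey [E theta nu (y - w)]linearB Ew opprB addrA subrK.
rewrite (le_lt_trans (rnormD _ _))// rnormN.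
move: yw; rewrite ltr_pdivlMr ?ltr_wpDl//; apply: le_lt_trans.
by rewrite mulrDr mulr1 addrC lerD2r mulrC; exact: EK.
Unshelve. all: by end_near. Qed.

(** Beyond the extent of [sigma] the ramps are constant on [sigma]. *)
Lemma family_off_spectrum theta x : circle theta ->
  exists M : R, (forall nu, M <= nu -> E theta nu x = x) /\
                (forall nu, nu < - M -> E theta nu x = 0).
Proof.
move=> th; have [M MP] := compact_rnorm_le sigma_compact.
have Mdot (z : sigma) : `|dot (val z) theta| <= M.
  by rewrite (le_trans (dot_norm_le _ th))// MP//; exact: (set_valP z).
exists M; split=> nu Mn; apply: family_unique => //.
  near=> d; rewrite -[RHS](calc1 calc); congr (psi _ x); apply/funext => z.
  by rewrite /half_plane_ramp ramp_le// (le_trans _ Mn)// (le_trans (ler_norm _)).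
near=> d; rewrite -[RHS](calc0 calc x); congr (psi _ x); apply/funext => z.
have d0 : 0 < d by near: d; exact: nbhs_right_gt.
have dm : d < - M - nu by near: d; apply: nbhs_right_lt; rewrite subr_gt0.
rewrite /half_plane_ramp ramp_ge//.
have := Mdot z; rewrite ler_norml => /andP[+ _]; lra.
Unshelve. all: by end_near. Qed.

Lemma family_spectral theta : circle theta -> spectral_family (E theta).
Proof.
move=> th; split.
- have [K K0 EK] := family_bounded; exists K => mu.
  by apply: opnorm_le => // v; exact: EK.
- by move=> mu x; exact: family_proj.
- by move=> mu nu x; exact: family_min.
split=> [mu x|mu|x|x].
- exact: family_right_cvg.
- have [K K0 EK] := family_bounded.
  have [|x|L LE] := @bounded_linear_of R X X (fun x => x - E (- theta) (- mu) x) (1 + K).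
  + by move=> c u v; rewrite linearP opprD addrACA -scalerBr.
  + by rewrite (le_trans (rnormD _ _))// rnormN mulrDl mul1r lerD2l EK//; exact: circleN.
  by exists L => x; rewrite LE; exact: family_left_cvg.
- have [M [M1 _]] := family_off_spectrum x th.
  by apply: cvg_near_cst; apply: filterS (nbhs_pinfty_ge (num_real M)) => nu; exact: M1.
- have [M [_ M2]] := family_off_spectrum x th.
  by apply: cvg_near_cst; apply: filterS (nbhs_ninfty_lt (num_real (- M))) => nu; exact: M2.
Qed.

End Family.

(** * Functions with one-sided limits *)

Section Regulated.
Variables (R : realType) (X : normedModType R[i]) (u : R -> X).
Implicit Types (a b c e : R) (p : nat -> R).

Lemma partition_le p (n : nat) : (forall j, (j < n)%N -> p j <= p j.+1) ->
  forall i j, (i <= j <= n)%N -> p i <= p j.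
Proof.
move=> pS i j /andP[]; elim: j => [|j IH] ij jn.
  by move: ij; rewrite leqn0 => /eqP ->.
move: ij; rewrite leq_eqVlt => /predU1P[->//|ij].
by rewrite (le_trans _ (pS _ jn))// IH// ltnW.
Qed.

(** The cells that contain [c] are contained in [[c - m, c + m]]; summing the
    increments of the truncation [k] to that interval telescopes. *)
Lemma sum_pieces_at p (n : nat) c (m : R) : (forall j, (j < n)%N -> p j <= p j.+1 <= p j + m) ->
  0 <= m ->
  \sum_(j < n) (if p j <= c <= p j.+1 then p j.+1 - p j else 0) <= 2 * m.
Proof.
move=> pS m0; pose k t := Num.max (c - m) (Num.min t (c + m)).
have k_mono s t : s <= t -> k s <= k t.
  move=> st; rewrite /k ge_max le_max lexx /= le_max; apply/orP; right.
  by rewrite le_min !ge_min st lexx orbT.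
apply: (@le_trans _ _ (\sum_(j < n) (k (p j.+1) - k (p j)))).
  apply: ler_sum => j _; have /andP[h1 h2] := pS _ (ltn_ord j).
  case: ifPn => [/andP[h3 h4]|_]; last by rewrite subr_ge0 k_mono.
  have kE t : c - m <= t -> t <= c + m -> k t = t.
    by move=> h5 h6; rewrite /k (min_l h6) max_r.
  by rewrite !kE//; lra.
rewrite -(big_mkord xpredT (fun j => k (p j.+1) - k (p j))) telescope_sumr//.
have kl t : c - m <= k t by rewrite le_max lexx.
have ku t : k t <= c + m by rewrite /k ge_max ge_min lexx orbT andbT; lra.
by have := kl (p 0); have := ku (p n); lra.
Qed.

Hypothesis u_left : forall c, exists l : X, u t @[t --> c^'-] --> l.
Hypothesis u_right : forall c, exists l : X, u t @[t --> c^'+] --> l.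

Lemma one_sided_oscillation c e : 0 < e -> exists2 d : R, 0 < d &
  (forall s t, c - d < s -> s <= t -> t < c -> rnorm (u t - u s) < e) /\
  (forall s t, c < s -> s <= t -> t < c + d -> rnorm (u t - u s) < e).
Proof.
move=> e0; have e20 : 0 < e / 2 by rewrite divr_gt0.
have [l /cvg_rnormP/(_ _ e20) lP] := u_left c.
have [r /cvg_rnormP/(_ _ e20) rP] := u_right c.
have [d1 /= d10 d1P] : exists2 d : R, 0 < d & forall t, c - d < t < c -> rnorm (l - u t) < e / 2.
  move: lP => /nbhs_ballP[d /= d0 dP]; exists d => // t /andP[dt tc].
  by apply: (dP t _ tc); rewrite /ball /= gtr0_norm ?subr_gt0//; lra.
have [d2 /= d20 d2P] : exists2 d : R, 0 < d & forall t, c < t < c + d -> rnorm (r - u t) < e / 2.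
  move: rP => /nbhs_ballP[d /= d0 dP]; exists d => // t /andP[ct td].
  by apply: (dP t _ ct); rewrite /ball /= distrC gtr0_norm ?subr_gt0//; lra.
have close (y : X) s t : rnorm (y - u s) < e / 2 -> rnorm (y - u t) < e / 2 -> rnorm (u t - u s) < e.
  move=> ys yt; rewrite (le_lt_trans (rnorm_triangle y _ _))// [e]splitr ltrD//.
  by rewrite rnormB.
exists (Num.min d1 d2); first by rewrite lt_min d10.
split=> s t.
  move=> cs st tc; apply: (close l); apply: d1P; apply/andP; split => //.
  - by rewrite (le_lt_trans _ cs)// lerB// ge_min lexx.
  - exact: le_lt_trans tc.
  - by rewrite (lt_le_trans _ st)// (le_lt_trans _ cs)// lerB// ge_min lexx.
move=> cs st tc; apply: (close r); apply: d2P; apply/andP; split => //.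
- by rewrite (le_lt_trans st)// (lt_le_trans tc)// lerD// ge_min lexx orbT.
- exact: lt_le_trans st.
- by rewrite (lt_le_trans tc)// lerD// ge_min lexx orbT.
Qed.

(** The supremum [c] of the endpoints [y] for which [[a, y]] has this property
    can be pushed further by [one_sided_oscillation], adding [c] and [y] to the
    exceptional points. *)
Lemma finite_oscillation a b e : a <= b -> 0 < e ->
  exists C : seq R, forall s t, a <= s -> s <= t -> t <= b ->
    (forall c, c \in C -> ~~ (s <= c <= t)) -> rnorm (u t - u s) < e.
Proof.
move=> ab e0.
pose Q y := exists C : seq R, forall s t, a <= s -> s <= t -> t <= y ->
    (forall c, c \in C -> ~~ (s <= c <= t)) -> rnorm (u t - u s) < e.
pose S := [set y | a <= y <= b /\ Q y].
have Sa : S a.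
  split; first by rewrite lexx.
  exists [::] => s t as_ st ta _.
  have -> : t = s by apply/eqP; rewrite eq_le st (le_trans ta).
  by rewrite subrr rnorm0.
have Sb y : S y -> y <= b by move=> [/andP[]].
have hS : has_sup S by split; [exists a|exists b].
pose c := sup S.
have [d d0 [dl dr]] := one_sided_oscillation c e0.
have [y Sy cy] := sup_adherent d0 hS; rewrite -/c in cy.
have yc : y <= c by apply: ub_le_sup => //; exists b.
have cb : c <= b by apply: ge_sup => //; exists a.
pose z := Num.min (c + d / 2) b.
have [/andP[ay _] [C CP]] := Sy.
have d20 : 0 < d / 2 by rewrite divr_gt0.
have cz : c <= z by rewrite le_min cb andbT; lra.
have Qz : Q z.
  (* An interval avoiding [c] and [y] lies left of [y], or in ]y, c[, or beyond [c]. *)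
  exists [:: c, y & C] => s t as_ st tz sC.
  have [ty|yt] := leP t y.
    by apply: CP => // r rC; apply: sC; rewrite !inE rC !orbT.
  have ys : y < s.
    rewrite ltNge; apply/negP => sy.
    by have := sC y; rewrite !inE eqxx orbT sy (ltW yt) => /(_ isT).
  have tc : t < c + d.
    by rewrite (le_lt_trans tz)// (@le_lt_trans _ _ (c + d / 2)) ?ge_min ?lexx//; lra.
  have := sC c; rewrite !inE eqxx => /(_ isT).
  rewrite negb_and -!ltNge => /orP[cs|tc'].
    exact: dr.
  by apply: dl => //; lra.
have Sz : S z by split => //; rewrite (le_trans ay)/= ?(le_trans yc)//= ge_min lexx orbT.
have zc : z <= c by apply: ub_le_sup => //; exists b.
have bz : z = b.
  move: zc; rewrite /z; case: (leP (c + d / 2) b) => // _; lra.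
by rewrite -bz.
Qed.

(** Cells that avoid the exceptional points contribute at most [e1 * (b - a)];
    the others have total length at most [2 * m] for each exceptional point. *)
Lemma mesh_sum_cvg0 a b e (B : R) : a <= b -> 0 < e ->
  (forall t, rnorm (u t) <= B) ->
  exists2 eta : R, 0 < eta & forall p (n : nat) (m : R), p 0%N = a -> p n = b ->
    (forall j, (j < n)%N -> p j <= p j.+1 <= p j + m) -> 0 <= m -> m < eta ->
    \sum_(j < n) (p j.+1 - p j) * rnorm (u (p j.+1) - u (p j)) < e.
Proof.
move=> ab e0 uB; have B0 : 0 <= B by rewrite (le_trans (rnorm_ge0 (u 0))).
pose e1 := e / 2 / (b - a + 1).
have ba : 0 < b - a + 1 by rewrite ltr_wpDl// subr_ge0.
have e10 : 0 < e1 by rewrite !divr_gt0.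
have [C CP] := finite_oscillation ab e10.
pose N : R := (size C)%:R; have N0 : 0 <= N by rewrite ler0n.
have BN0 : 0 <= 4 * B * N by rewrite !mulr_ge0.
exists (e / 2 / (4 * B * N + 1)); first by rewrite !divr_gt0// ltr_wpDl.
move=> p n m p0 pn pS m0 meta.
have pS' j : (j < n)%N -> p j <= p j.+1 by move=> /pS/andP[].
have pa i : (i <= n)%N -> a <= p i by move=> iN; rewrite -p0; apply: (partition_le pS').
have pb i : (i <= n)%N -> p i <= b by move=> iN; rewrite -pn; apply: (partition_le pS'); rewrite iN /=.
have du s t : rnorm (u t - u s) <= 2 * B.
  by rewrite (le_trans (rnormD _ _))// rnormN; have := uB s; have := uB t; lra.
pose hit c (j : nat) : R := if p j <= c <= p j.+1 then p j.+1 - p j else 0.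
apply: (@le_lt_trans _ _ (\sum_(j < n) (e1 * (p j.+1 - p j) + 2 * B * \sum_(c <- C) hit c j))).
  apply: ler_sum => j _; have jn := ltn_ord j.
  have dp : 0 <= p j.+1 - p j by rewrite subr_ge0 pS'.
  have hit0 c : 0 <= hit c j by rewrite /hit; case: ifP.
  have [/hasP[c cC cj]|/hasPn noC] := boolP (has (fun c => p j <= c <= p j.+1) C).
    rewrite (@le_trans _ _ (2 * B * (p j.+1 - p j)))//.
      by rewrite mulrC ler_wpM2r.
    apply: ler_wpDl; first by rewrite mulr_ge0// ltW.
    apply: ler_wpM2l; first by rewrite mulr_ge0.
    rewrite (big_rem c)//= {1}/hit cj lerDl; exact: sumr_ge0.
  apply: ler_wpDr; first by rewrite !mulr_ge0 ?sumr_ge0.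
  rewrite mulrC ler_wpM2r// ltW//.
  apply: CP => //; first by apply: pa; exact: ltnW.
  - exact: pS'.
  - exact: pb.
rewrite big_split /= -!mulr_sumr exchange_big /=.
rewrite -(big_mkord xpredT (fun j => p j.+1 - p j)) telescope_sumr// p0 pn.
rewrite [ltRHS]splitr; apply: ltr_leD.
  rewrite /e1 mulrAC ltr_pdivrMr// ltr_pM2l ?divr_gt0//; lra.
apply: (@le_trans _ _ (2 * B * (N * (2 * m)))).
  rewrite ler_wpM2l ?mulr_ge0//.
  apply: (@le_trans _ _ (\sum_(c <- C) 2 * m)).
    by apply: ler_sum => c _; exact: sum_pieces_at.
  by rewrite big_const_seq count_predT iter_addr_0 -[leLHS]mulr_natl.
move: meta; rewrite ltr_pdivlMr ?ltr_wpDl// => meta.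
have : m * (4 * B * N) <= m * (4 * B * N + 1) by rewrite ler_wpM2l// lerDl.
have -> : 2 * B * (N * (2 * m)) = m * (4 * B * N) by ring.
lra.
Qed.

End Regulated.

(** * The spectral integral and the recovery of the operator *)

Lemma sum_ramp (R : realType) (p : nat -> R) (n : nat) (t : R) :
  (forall j, (j < n)%N -> p j < p j.+1) -> p 0%N <= t <= p n ->
  \sum_(j < n) (p j.+1 - p j) * ramp (p j) (p j.+1 - p j) t = p n - t.
Proof.
move=> pS /andP[t0 tn]; pose k j := Num.max (p j - t) 0.
have kE (j : 'I_n) : (p j.+1 - p j) * ramp (p j) (p j.+1 - p j) t = k j.+1 - k j.
  have pj := pS _ (ltn_ord j); have d0 : 0 < p j.+1 - p j by rewrite subr_gt0.
  rewrite /k; have [h|h] := leP t (p j).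
    rewrite ramp_le// !max_l; [ring|lra|lra].
  have [h'|h'] := leP (p j.+1) t.
    rewrite ramp_ge//; last lra.
    rewrite !max_r; [ring|lra|lra].
  rewrite ramp_mid//; last by apply/andP; split; lra.
  rewrite max_l; last lra.
  rewrite max_r; last lra.
  by field; rewrite gt_eqF.
under eq_bigr do rewrite kE.
rewrite -(big_mkord xpredT (fun j => k j.+1 - k j)) telescope_sumr//.
by rewrite /k max_l ?subr_ge0// max_r ?subr_le0// subr0.
Qed.

(** Abel summation, which brings the Stieltjes sum to the form
    [b - sum_j (t_(j+1) - t_j) * E t_j] parallel to [sum_ramp]. *)
Lemma sum_by_parts (R : realType) (X : normedModType R[i]) (p : nat -> R) (v : nat -> X) (n : nat) :
  (p 0%N)%:C *: v 0%N + \sum_(j < n) (p j.+1)%:C *: (v j.+1 - v j) =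
  (p n)%:C *: v n - \sum_(j < n) (p j.+1 - p j)%:C *: v j.
Proof.
elim: n => [|n IH]; first by rewrite !big_ord0 addr0 subr0.
rewrite !big_ord_recr /= addrA IH rmorphB /= scalerBl scalerBr.
set A := _ *: v n; set B := \sum_(j < n) _; set C := _ *: v n.+1; set D := _ *: v n.
by rewrite opprD opprB [A - B]addrC addrACA [- B + C]addrC -addrA.
Qed.

Section Integral.
Variables (R : realType) (sigma : set R[i]) (X : completeNormedModType R[i]).
Variables (T : bounded_op X) (psi : (sigma -> R[i]) -> bounded_op X).
Hypothesis sigma_neq0 : sigma !=set0.
Hypothesis sigma_compact : compact sigma.
Hypothesis calc : is_functional_calculus psi T.
Implicit Types (theta : R[i]) (mu nu d : R) (f g : sigma -> R[i]) (x : X).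

Local Notation h := (@half_plane_ramp R sigma).
Let hA := AC_ramp sigma_neq0 sigma_compact.

Lemma AC_zero : ACfun (0 : sigma -> R[i]).
Proof. by rewrite -[0](subrr (1 : sigma -> R[i])); apply: AC_sub; exact: AC_one. Qed.

Lemma calc_sum (n : nat) (c : nat -> R[i]) (f : nat -> sigma -> R[i]) :
  (forall j, (j < n)%N -> ACfun (f j)) ->
  ACfun (\sum_(j < n) c j *: f j) /\
  forall x, psi (\sum_(j < n) c j *: f j) x = \sum_(j < n) c j *: psi (f j) x.
Proof.
elim: n => [|n IH] fA.
  by rewrite big_ord0; split=> [|x]; [exact: AC_zero|rewrite big_ord0 (calc0 calc)].
have [|sA sE] := IH; first by move=> j jn; apply: fA; exact: ltnW.
have nA : ACfun (c n *: f n) by apply: AC_scale; exact: fA.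
split=> [|x]; first by rewrite big_ord_recr; exact: AC_add.
by rewrite !big_ord_recr /= (calcD calc)// sE (calcZ calc)//; exact: fA.
Qed.

(** For a unit vector [theta] the numbers [dot z theta] and
    [dot z (i * theta)] are the coordinates of [z] in the orthonormal frame
    [(theta, i * theta)]. *)
Lemma calc_recover theta x : circle theta ->
  T x = theta *: psi (plane_fun theta id) x +
        ('i%C * theta) *: psi (plane_fun ('i%C * theta) id) x.
Proof.
move=> th; have [_ _ _ _ [_ <-]] := calc.
rewrite -!(calcZ calc); [|exact: AC_plane_id..].
rewrite -(calcD calc); [|by apply: AC_scale; exact: AC_plane_id..].
congr (psi _ x); apply/funext => z.
have zE (w : R[i]) : w = theta * (dot w theta)%:C + 'i%C * theta * (dot w ('i%C * theta))%:C.
  have := circleE th; case: theta w {th} => [c d] [a b] /= cd1; rewrite /dot /=; simpc.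
  by apply/eqP; rewrite eq_complex /=; apply/andP; split; apply/eqP;
    [rewrite -{1}[a]mulr1|rewrite -{1}[b]mulr1]; rewrite -cd1; ring.
exact: zE.
Qed.

Variable E : R[i] -> R -> bounded_op X.
Hypothesis EL : forall theta mu x, circle theta ->
  psi (h theta mu d) x @[d --> 0^'+] --> E theta mu x.

(** The error term is
    [sum_j (t_(j+1) - t_j) * psi h_j (E t_j x - E t_(j+1) x)], where [h_j] is
    the ramp on the cell [j]: [h_j] is absorbed by [E t_(j+1)] and fixes
    [E t_j]. *)
Lemma calc_dot_integral theta : circle theta ->
  is_spectral_integral [set dot z theta | z in sigma] (E theta)
    (psi (plane_fun theta id)).
Proof.
move=> th a b sab x e e0.
have sab' (z : sigma) : a <= dot (val z) theta <= b.
  have := sab (dot (val z) theta); rewrite /= in_itv /=; apply.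
  by exists (val z) => //; exact: (set_valP z).
have ab : a <= b.
  have [z0 sz0] := sigma_neq0.
  by have /andP[h1 h2] := sab' (SigSub (mem_set sz0)); rewrite (le_trans h1).
have [K K0 EK] := family_bounded sigma_neq0 sigma_compact calc EL.
have [K' K'0 [KP _]] := calc_ramp_bounded sigma_neq0 sigma_compact calc.
have eK : 0 < e / (K' + 1) by rewrite divr_gt0// ltr_wpDl.
have EB t : rnorm (E theta t x) <= K * rnorm x by exact: EK.
have [||eta eta0 etaP] := @mesh_sum_cvg0 R X (fun t => E theta t x) _ _ a b _ _ ab eK EB.
- move=> c; exists (x - E (- theta) (- c) x).
  exact: (family_left_cvg sigma_neq0 sigma_compact calc EL).
- move=> c; exists (E theta c x).
  exact: (family_right_cvg sigma_neq0 sigma_compact calc EL).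
exists eta => // s abs meta.
pose p j := nth 0 (a :: s) j; pose n := size s.
have p0 : p 0%N = a by [].
have pn : p n = b by rewrite /p /n (itv_partition_nth_size _ abs).
have pS j : (j < n)%N -> p j < p j.+1.
  by move=> jn; have [/(pathP 0)/(_ j jn)] := abs.
have dj j : (j < n)%N -> 0 < p j.+1 - p j by move=> /pS; rewrite subr_gt0.
have mesh_le j : (j < n)%N -> p j.+1 - p j <= mesh a s.
  by move=> jn; rewrite /mesh (le_bigmax _ (fun j : 'I_(size s) => p j.+1 - p j) (Ordinal jn)).
have mesh0 : 0 <= mesh a s by rewrite /mesh bigmax_ge_id.
have fE : plane_fun theta id =
    b%:C *: (1 : sigma -> R[i]) - \sum_(j < n) (p j.+1 - p j)%:C *: h theta (p j) (p j.+1 - p j).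
  apply/funext => z.
  have := @sum_ramp R p n (dot (val z) theta) pS; rewrite p0 pn => /(_ (sab' z)) sE.
  have -> : plane_fun theta id z = (b - \sum_(j < n) (p j.+1 - p j) *
      ramp (p j) (p j.+1 - p j) (dot (val z) theta))%:C.
    by rewrite sE opprB addrC subrK.
  rewrite rmorphB rmorph_sum /=.
  have -> : forall F G : sigma -> R[i], (F - G) z = F z - G z by [].
  rewrite fct_sumE; congr (_ - _); first by rewrite -[RHS]/(b%:C * 1) mulr1.
  by apply: eq_bigr => j _; rewrite rmorphM.
have [|sumA sumE] := @calc_sum n (fun j => (p j.+1 - p j)%:C) (fun j => h theta (p j) (p j.+1 - p j)).
  by move=> j jn; apply: hA => //; exact: dj.
have A1 : ACfun (b%:C *: (1 : sigma -> R[i])) by apply: AC_scale; exact: AC_one.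
have Eb : E theta b x = x.
  apply: (family_unique EL) => //; apply: filterE => d.
  rewrite -[RHS](calc1 calc); congr (psi _ x); apply/funext => z.
  by rewrite /half_plane_ramp ramp_le//; have /andP[] := sab' z.
have -> : psi (plane_fun theta id) x - (a%:C *: E theta a x + stieltjes_sum (E theta) a s x) =
    \sum_(j < n) (p j.+1 - p j)%:C *: psi (h theta (p j) (p j.+1 - p j)) (E theta (p j) x - E theta (p j.+1) x).
  have := sum_by_parts p (fun j => E theta (p j) x) n.
  rewrite p0 pn Eb /stieltjes_sum -/n => ->.
  rewrite fE (calcB calc)// sumE (calcZ calc) ?(calc1 calc); last exact: AC_one.
  rewrite opprB addrC addrA subrK -sumrB; apply: eq_bigr => j _.
  have d0 := dj _ (ltn_ord j).
  rewrite linearB /= (calc_family_fix sigma_neq0 sigma_compact calc EL)//.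
  rewrite (calc_family_absorb sigma_neq0 sigma_compact calc EL)// ?scalerBr//.
  by rewrite addrC subrK.
rewrite (le_lt_trans (rnorm_sum _ _ _))//.
apply: (@le_lt_trans _ _ (K' * \sum_(j < n) (p j.+1 - p j) * rnorm (E theta (p j.+1) x - E theta (p j) x))).
  rewrite mulr_sumr; apply: ler_sum => j _; have d0 := dj _ (ltn_ord j).
  rewrite rnormZr; last exact: ltW.
  by rewrite mulrCA ler_wpM2l ?(ltW d0)// [X in K' * X]rnormB KP.
have pm j : (j < n)%N -> p j <= p j.+1 <= p j + mesh a s.
  by move=> jn; rewrite (ltW (pS _ jn)) -lerBlDl mesh_le.
have := etaP p n (mesh a s) p0 pn pm mesh0 meta.
rewrite ltr_pdivlMr ?ltr_wpDl//; apply: le_lt_trans.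
rewrite [leLHS]mulrC ler_wpM2l ?lerDl//.
by apply: sumr_ge0 => j _; rewrite mulr_ge0 ?rnorm_ge0// ltW// dj.
Qed.

End Integral.

(** Evaluate membership at [s * theta + t * i * theta]; the two half-planes
    agree for all [s] and [t] only if [theta'] is [theta].  This makes the
    operator attached to a half-plane well defined. *)
Lemma half_plane_inj (R : realType) (theta theta' : R[i]) (mu mu' : R) :
  circle theta -> circle theta' -> half_plane theta mu = half_plane theta' mu' ->
  theta = theta' /\ mu = mu'.
Proof.
move=> /circleE th /circleE th' hE.
pose a := dot theta theta'; pose b := dot ('i%C * theta) theta'.
have key s t : (s <= mu) = (s * a + t * b <= mu').
  have : half_plane theta mu (s%:C * theta + t%:C * ('i%C * theta)) =
         half_plane theta' mu' (s%:C * theta + t%:C * ('i%C * theta)) by rewrite hE.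
  rewrite /half_plane /= => /propeqP; set u := dot _ _; set v := dot _ _.
  have -> : u = s.
    rewrite /u; case: theta th {a b hE u v} => [c d] /= th; rewrite /dot /=; simpc => /=.
    by rewrite -[RHS]mulr1 -th; ring.
  have -> : v = s * a + t * b.
    rewrite /v /a /b; case: theta theta' {th th' a b hE u v} => [c d] [c' d'].
    by rewrite /dot /=; simpc => /=; ring.
  by move=> [h1 h2]; apply/idP/idP.
have ab1 : a ^+ 2 + b ^+ 2 = 1.
  rewrite /a /b; case: theta theta' th th' {a b hE key} => [c d] [c' d'] /= th th'.
  by rewrite /dot /=; simpc => /=; rewrite -[RHS]mulr1 -{1}th -th'; ring.
have b0 : b = 0.
  apply: contrapT => /eqP b0; have := key mu ((mu' + 1 - mu * a) / b).
  by rewrite lexx divfK// addrCA subrr addr0 gerDl ler10.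
have a1 : a = 1.
  move: ab1; rewrite b0 expr0n /= addr0 => /eqP; rewrite sqrf_eq1 => /orP[/eqP//|/eqP aN1].
  have := key (Num.min mu (- mu' - 1)) 0; rewrite ge_min lexx aN1 mul0r addr0 mulrN1.
  move=> /esym; rewrite lerNl le_min => /andP[_]; lra.
split.
  move: a1 b0; rewrite /a /b; case: theta theta' th th' {a b hE key ab1} => [c d] [c' d'] /= th th'.
  rewrite /dot /=; simpc => /= a1 b0.
  apply/eqP; rewrite eq_complex /=; apply/andP; split; apply/eqP.
    have -> : c' = c * (c * c' + d * d') - d * (- (d * c') + c * d') by rewrite -[LHS]mulr1 -th; ring.
    by rewrite a1 b0 mulr1 mulr0 subr0.
  have -> : d' = d * (c * c' + d * d') + c * (- (d * c') + c * d') by rewrite -[LHS]mulr1 -th; ring.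
  by rewrite a1 b0 mulr1 mulr0 addr0.
apply/eqP; rewrite eq_le; apply/andP; split.
  by have := key mu 0; rewrite lexx a1 mulr1 mul0r addr0.
by have := key mu' 0; rewrite a1 mulr1 mul0r addr0 lexx.
Qed.

Theorem mainTheorem5 (R : realType) (sigma : set R[i])
    (X : completeNormedModType R[i]) (T : bounded_op X)
    (psi : (sigma -> R[i]) -> bounded_op X)
    (sigma_neq0 : sigma !=set0) (sigma_compact : compact sigma)
    (psi_calculus : is_functional_calculus psi T)
    (psi_type_B : is_type_B psi) :
  exists E : set R[i] -> bounded_op X,
    [/\ forall theta mu, circle theta ->
          wot_cvg 0^'+ (fun delta => psi (half_plane_ramp theta mu delta))
            (E (half_plane theta mu)),
        half_plane_spectral_family E &
        exists S : R[i] -> bounded_op X,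
          [/\ forall theta, circle theta ->
                is_spectral_integral [set dot z theta | z in sigma]
                  (fun mu => E (half_plane theta mu)) (S theta),
              forall theta x, circle theta ->
                T x = theta *: S theta x + ('i%C * theta) *: S ('i%C * theta) x &
              forall x, T x = S 1 x + 'i%C *: S 'i%C x]].
Proof.
have limit_ex (H : set R[i]) : exists B : bounded_op X, forall theta mu,
    circle theta -> H = half_plane theta mu ->
    forall x, psi (half_plane_ramp theta mu d) x @[d --> 0^'+] --> B x.
  have [[theta [mu [th ->]]]|noH] :=
      pselect (exists theta mu, circle theta /\ H = half_plane theta mu).
    have [B BL] := half_plane_projection_ex sigma_neq0 sigma_compact psi_calculus mu psi_type_B th.
    by exists B => theta' mu' th' /(half_plane_inj th th')[<- <-].
  by exists (psi 0) => theta mu th HE; exfalso; apply: noH; exists theta, mu.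
have [E EP] := choice limit_ex.
pose E0 theta mu := E (half_plane theta mu).
have EL theta mu x : circle theta ->
    psi (half_plane_ramp theta mu d) x @[d --> 0^'+] --> E0 theta mu x.
  by move=> th; exact: EP.
exists E; split.
- by move=> theta mu th x phi; apply: cvg_bounded_linear; exact: EL.
- split.
  + move=> _ [theta [mu [th ->]]] x.
    exact: (family_proj sigma_neq0 sigma_compact psi_calculus EL).
  + move=> _ _ x [theta [mu [th ->]]] [theta' [mu' [th' ->]]].
    exact: (family_comm sigma_neq0 sigma_compact psi_calculus EL).
  + have [K K0 EK] := family_bounded sigma_neq0 sigma_compact psi_calculus EL.
    exists K => _ [theta [mu [th ->]]].
    by apply: opnorm_le => // v; exact: EK.
  + move=> theta th.
    exact: (family_spectral sigma_neq0 sigma_compact psi_calculus EL).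
  + move=> theta mu1 mu2 x th m12.
    exact: (family_opposite sigma_neq0 sigma_compact psi_calculus EL).
exists (fun theta => psi (plane_fun theta id)); split.
- by move=> theta th; exact: (calc_dot_integral sigma_neq0 sigma_compact psi_calculus EL).
- by move=> theta x th; exact: calc_recover.
- move=> x; have c1 : circle (1 : R[i]) by rewrite /circle /= normr1.
  by have := calc_recover psi_calculus x c1; rewrite mulr1 scale1r.
Qed.
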